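(* Let $n\in\mathbb{N}$. (1) An element $g\in G_f(X_* )$ belongs to $\overline{G_f(X_* )}_n$ if and only if all moments of order $\le n$ vanish at $g$. (2) $\overline{G(X_* )}_n=\overline{G_f(X_* )}_n\cap G(X_* )$.
   Context: Lower central series. For a topological group $H$ put $H_1=[H,H]$ (commutator subgroup) and $H_n=[H,H_{n-1}]$ for $n\ge2$; $\overline{H}_n$ denotes the closure of $H_n$ in $H$. Algebra. Let $\mathbb{C}\langle X_1,X_2,\dots\rangle$ be the associative algebra with unit $I$ of complex noncommutative polynomials in free noncommuting variables $X_1,X_2,\dots$. Let $\mathcal{A}\subset\mathbb{C}\langle X_1,X_2,\dots\rangle[[t]]$ be the subalgebra of formal power series of the form $f=c_0I+\sum_{n\ge1}\big(\sum_{i_1+\cdots+i_k=n}c_{i_1,\dots,i_k}X_{i_1}\cdots X_{i_k}\big)t^n$ with complex coefficients (inner sum over all $k\ge1$ and all $(i_1,\dots,i_k)\in\mathbb{N}^k$ with sum $n$). Equip $\mathcal{A}$ with the weakest topology making all coefficient functions continuous. Let $G\subset\mathcal{A}$ be the topological group (under multiplication) of elements with $c_0=1$. Paths. Fix $T>0$, $I_T=[0,T]$. $X$ is the set of sequences $a=(a_1,a_2,\dots)$ of complex-valued functions $a_i\in L^\infty(I_T)$ with $\sup_{x\in I_T,\,i\in\mathbb{N}}|a_i(x)|^{1/i}<\infty$. For $a\in X$ let $F_a:I_T\to G$ be the solution (by Picard iteration, with coefficients Lipschitz in $x$) of $F'(x)=\big(\sum_{i\ge1}a_i(x)t^iX_i\big)F(x)$,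 $F_a(0)=I$, and set $E(a)=F_a(T)\in G$. The set $G(X):=E(X)$ is a subgroup of $G$ (the group of paths), and the group of formal paths $G_f(X)$ is the closure of $G(X)$ in $G$. (The paper defines $G(X)$ as a quotient of $X$ and $G_f(X)$ as its metric completion, and identifies them with these subgroups of $G$.) Let $X_*\subset X$ be the set of $a$ with $\int_0^Ta_s(x)\,dx=0$ for all $s\in\mathbb{N}$. Then $G(X_* ):=E(X_* )$ is the subgroup of closed paths and $G_f(X_* )$, its closure in $G_f(X)$, is the subgroup of formal closed paths; both carry the induced topology. Moments. For $a\in X$ put $\widetilde a_i(x)=\int_0^xa_i(s)\,ds$. Let $\mathcal{P}(X)$ be the set of functions on $X\times I_T$ of the form $(a,x)\mapsto(\widetilde a_{i_1}(x))^{n_1}\cdots(\widetilde a_{i_k}(x))^{n_k}\cdot a_{i_{k+1}}(x)$ with $i_1,\dots,i_{k+1}\in\mathbb{N}$ and $n_1,\dots,n_k\in\mathbb{Z}_+$ (nonnegative integers). A moment of order $k\ge1$ on $X$ is a function $$m(a)=\int\cdots\int_{0\le s_1\le\cdots\le s_k\le T}p_k(a;s_k)\cdots p_1(a;s_1)\,ds_k\cdots ds_1,\qquad p_1,\dots,p_k\in\mathcal{P}(X).$$ Each moment $m$ is a finite linear combination of basic iterated integrals $\int\cdots\int_{0\le s_1\le\cdots\le s_k\le T}a_{i_k}(s_k)\cdots a_{i_1}(s_1)\,ds_k\cdots ds_1$, and there is a unique continuous function $\widehat m$ on $G_f(X)$ with $\widehat m(E(a))=m(a)$ for all $a\in X$;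 $\widehat m$ is called a moment on $G_f(X)$, of the same order as $m$. *)

(* Defs.v *)
From HB Require Import structures.
From mathcomp Require Import all_boot all_order all_algebra.
From mathcomp Require Import all_classical all_reals all_analysis.
From mathcomp Require Import complex.
Set Implicit Arguments.
Unset Strict Implicit.
Unset Printing Implicit Defensive.
Import Order.TTheory GRing.Theory Num.Theory.
Import numFieldNormedType.Exports.
Local Open Scope classical_set_scope.
Local Open Scope ring_scope.
Local Open Scope complex_scope.

(* Index convention: positive integer indices are shifted down by one, so that
   [i : nat] stands for the variable X_(i+1) and the path component a_(i+1). *)

Section Commutators.
Variable G : groupType.

Definition is_subgroup (H : set G) : Prop :=
  [/\ H 1%g, (forall x y, H x -> H y -> H (x * y)%g)
    & forall x, H x -> H (x^-1)%g].

Definition comm_subgroup (A B : set G) : set G :=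
  smallest is_subgroup [set z | exists x y, [/\ A x, B y & z = [~ x, y]%g]].

(* The series starts at [lower_central H 1 = [H, H]]; the value at 0 only seeds
   the recursion. *)
Fixpoint lower_central (H : set G) (n : nat) : set G :=
  if n is k.+1 then comm_subgroup H (lower_central H k) else H.

End Commutators.

(* The closure of S in the subspace H. *)
Definition closure_in (U : topologicalType) (H S : set U) : set U :=
  closure S `&` H.

(* The power of t in front of the monomial X_(i_1) ... X_(i_k) is forced to be
   i_1 + ... + i_k, so an element of the algebra is exactly the family of its
   coefficients c_(i_1, ..., i_k), indexed by words; [f [::]] is c_0. *)
Definition ncseries (R : realType) : Type := seq nat -> R[i].

Section SeriesRing.
Variable R : realType.
Implicit Types (f g h : ncseries R) (w : seq nat).

HB.instance Definition _ :=
  GRing.Zmodule.copy (ncseries R) (seq nat -> R[i]).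

(* [prod_topology] is the weakest topology for which all coefficient functions
   are continuous. *)
HB.instance Definition _ :=
  Topological.copy (ncseries R) (prod_topology (fun _ : seq nat => R[i]^o)).

Definition ncone : ncseries R := fun w => (w == [::])%:R.

Definition ncmul f g : ncseries R :=
  fun w => \sum_(i < (size w).+1) f (take i w) * g (drop i w).

Let shift i f : ncseries R := fun w => f (i :: w).

Let ncmul_nil f g : ncmul f g [::] = f [::] * g [::].
Proof. by rewrite /ncmul big_ord_recl big_ord0 addr0. Qed.

Let ncmul_cons f g i w :
  ncmul f g (i :: w) = f [::] * g (i :: w) + ncmul (shift i f) g w.
Proof. by rewrite /ncmul big_ord_recl. Qed.

Let ncmul_linl a f g h w :
  ncmul (fun v => a * f v + g v) h w = a * ncmul f h w + ncmul g h w.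
Proof.
rewrite /ncmul big_distrr -big_split /=; apply: eq_bigr => j _.
by rewrite mulrDl mulrA.
Qed.

Fact ncmulA : associative ncmul.
Proof.
move=> f g h; apply/funext => w; elim: w f g h => [|i w IH] f g h.
  by rewrite !ncmul_nil mulrA.
rewrite !ncmul_cons ncmul_nil IH.
have -> : shift i (ncmul f g)
    = (fun v => f [::] * shift i g v + ncmul (shift i f) g v).
  by apply/funext => v; rewrite /shift ncmul_cons.
by rewrite ncmul_linl mulrDr !mulrA addrA.
Qed.

Fact ncmul1r : left_id ncone ncmul.
Proof.
move=> f; apply/funext => w; rewrite /ncmul big_ord_recl take0 drop0 mul1r.
rewrite big1 ?addr0// => j _; case: w j => [[]//|i w] j.
by rewrite /ncone /= mul0r.
Qed.

Fact ncmulr1 : right_id ncone ncmul.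
Proof.
move=> f; apply/funext => w; rewrite /ncmul big_ord_recr /= take_size drop_size.
rewrite mulr1 big1 ?add0r// => j _.
by rewrite /ncone -size_eq0 size_drop subn_eq0 leqNgt ltn_ord mulr0.
Qed.

Fact ncmulDl : left_distributive ncmul +%R.
Proof.
move=> f g h; apply/funext => w; rewrite {2}/GRing.add /= /ncmul -big_split /=.
by apply: eq_bigr => j _; rewrite -mulrDl.
Qed.

Fact ncmulDr : right_distributive ncmul +%R.
Proof.
move=> f g h; apply/funext => w; rewrite {2}/GRing.add /= /ncmul -big_split /=.
by apply: eq_bigr => j _; rewrite -mulrDr.
Qed.

Fact ncone_neq0 : ncone != 0.
Proof. by apply/eqP => /(congr1 (@^~ [::]))/eqP; rewrite oner_eq0. Qed.

HB.instance Definition _ := GRing.Zmodule_isNzRing.Build (ncseries R)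
  ncmulA ncmul1r ncmulr1 ncmulDl ncmulDr ncone_neq0.

Let nc_sumE (I : Type) (r : seq I) (F : I -> ncseries R) w :
  (\sum_(i <- r) F i) w = \sum_(i <- r) F i w.
Proof. by elim/big_rec2: _ => // i y z _ <-. Qed.

(* The inverse of f when c_0 = 1: only the terms k <= size w of the geometric
   series \sum_k (1 - f)^k contribute to the coefficient of w. *)
Definition ncinv f : ncseries R :=
  fun w => (\sum_(k < (size w).+1) (1 - f) ^+ k) w.

Let nilpow f n w : f [::] = 0 -> (size w < n)%N -> (f ^+ n) w = 0.
Proof.
move=> f0; elim: n w => [//|n IH] w wn; rewrite exprS.
rewrite [LHS]/(ncmul _ _ w) /ncmul big1// => -[[|j] jw] _ /=.
  by rewrite take0 f0 mul0r.
rewrite IH ?mulr0// size_drop; case: w wn jw => //= _ w wn _.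
by rewrite subSS (leq_ltn_trans (leq_subr _ _)).
Qed.

Let ncinvE f n w : f [::] = 1 -> (size w <= n)%N ->
  ncinv f w = (\sum_(k < n.+1) (1 - f) ^+ k) w.
Proof.
move=> f1 wn; rewrite /ncinv !nc_sumE.
rewrite -!(big_mkord xpredT (fun k => ((1 - f) ^+ k) w)).
rewrite [RHS](big_cat_nat (n := (size w).+1))//= [X in _ = _ + X]big_nat_cond.
rewrite [X in _ = _ + X]big1 ?addr0// => k /andP[/andP[wk _] _].
apply: nilpow wk.
by rewrite [LHS](_ : _ = 1 - f [::])// f1 subrr.
Qed.

Fact ncmulrV f : f [::] = 1 -> f * ncinv f = 1.
Proof.
move=> f1; apply/funext => w; set n := size w.
have u0 : (1 - f) [::] = 0 by rewrite [LHS](_ : _ = 1 - f [::])// f1 subrr.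
transitivity ((f * \sum_(k < n.+1) (1 - f) ^+ k) w).
  apply: eq_bigr => j _; congr (_ * _).
  by apply: ncinvE => //; rewrite size_drop leq_subr.
set u := 1 - f in u0 *.
have -> : f = - (u - 1) by rewrite /u addrC addrA addNr sub0r opprK.
rewrite mulNr -subrX1 opprB [LHS](_ : _ = (1 : ncseries R) w - (u ^+ n.+1) w)//.
by rewrite nilpow// subr0.
Qed.

Fact ncmulVr f : f [::] = 1 -> ncinv f * f = 1.
Proof.
move=> f1.
have g1 : ncinv f [::] = 1.
  by rewrite /ncinv big_ord_recl big_ord0 addr0 expr0.
have fhk : f = ncinv (ncinv f).
  by rewrite -[LHS]mulr1 -(ncmulrV g1) mulrA ncmulrV// mul1r.
by rewrite {2}fhk ncmulrV.
Qed.

End SeriesRing.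

(* The topological group G of series with c_0 = 1; as a [set_type] it carries
   the subspace topology. *)
Definition ncgroup (R : realType) : Type :=
  set_type [set f : ncseries R | f [::] = 1].

Section SeriesGroup.
Variable R : realType.
Implicit Types f g h : ncgroup R.

HB.instance Definition _ := Topological.on (ncgroup R).

Let ncgroupP f : (\val f : ncseries R) [::] = 1.
Proof. by case: f => f /= /set_mem. Qed.

Fact ncgroup_one_subproof : (1 : ncseries R) [::] = 1.
Proof. by []. Qed.

Fact ncgroup_mul_subproof f g : (\val f * \val g : ncseries R) [::] = 1.
Proof.
by rewrite [LHS]/(ncmul _ _ _) /ncmul big_ord_recl big_ord0 addr0 !ncgroupP
  mulr1.
Qed.

Fact ncgroup_inv_subproof f : ncinv (\val f) [::] = 1.
Proof. by rewrite /ncinv big_ord_recl big_ord0 addr0 expr0. Qed.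

Definition ncgroup_one : ncgroup R :=
  exist _ (1 : ncseries R) (mem_set ncgroup_one_subproof).
Definition ncgroup_mul f g : ncgroup R :=
  exist _ (\val f * \val g : ncseries R) (mem_set (ncgroup_mul_subproof f g)).
Definition ncgroup_inv f : ncgroup R :=
  exist _ (ncinv (\val f)) (mem_set (ncgroup_inv_subproof f)).

Fact ncgroup_mulA : associative ncgroup_mul.
Proof. by move=> f g h; apply: val_inj; rewrite /= mulrA. Qed.
Fact ncgroup_mul1 : left_id ncgroup_one ncgroup_mul.
Proof. by move=> f; apply: val_inj; rewrite /= mul1r. Qed.
Fact ncgroup_mulr1 : right_id ncgroup_one ncgroup_mul.
Proof. by move=> f; apply: val_inj; rewrite /= mulr1. Qed.
Fact ncgroup_mulV : left_inverse ncgroup_one ncgroup_inv ncgroup_mul.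
Proof. by move=> f; apply: val_inj; rewrite /= ncmulVr// ncgroupP. Qed.
Fact ncgroup_mulrV : right_inverse ncgroup_one ncgroup_inv ncgroup_mul.
Proof. by move=> f; apply: val_inj; rewrite /= ncmulrV// ncgroupP. Qed.

HB.instance Definition _ := isMonoid.Build (ncgroup R)
  ncgroup_mulA ncgroup_mul1 ncgroup_mulr1.
HB.instance Definition _ := hasInv.Build (ncgroup R) ncgroup_inv.
HB.instance Definition _ := Monoid_isGroup.Build (ncgroup R)
  ncgroup_mulV ncgroup_mulrV.

End SeriesGroup.

Section Paths.
Variables (R : realType) (T : R).
Local Notation mu := (@lebesgue_measure R).
Local Notation G := (ncgroup R).
Local Notation cfun := (R -> R[i]).

Definition cintegral (D : set R) (f : cfun) : R[i] :=
  (\int[mu]_(x in D) complex.Re (f x)) +i* (\int[mu]_(x in D) complex.Im (f x)).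

Definition is_cderive (f : cfun) (x : R) (l : R[i]) : Prop :=
  is_derive x 1 (fun y => complex.Re (f y)) (complex.Re l) /\
  is_derive x 1 (fun y => complex.Im (f y)) (complex.Im l).

(* Sequences of representatives of L^oo classes on [0, T]: the supremum over x
   is an essential supremum, and a uniform bound on |a_i|^(1/i) also bounds each
   component. *)
Definition path_space : set (nat -> cfun) :=
  [set a : nat -> cfun |
    (forall i, measurable_fun `[0, T] (fun x => complex.Re (a i x)) /\
               measurable_fun `[0, T] (fun x => complex.Im (a i x))) /\
    exists M : R, forall i, {ae mu, forall x : R, x \in `[0, T] ->
      ComplexField.Normc.normc (a i x) `^ (i.+1%:R^-1) <= M}].

Definition closed_path_space : set (nat -> cfun) :=
  path_space `&` [set a : nat -> cfun | forall i, cintegral `[0, T] (a i) = 0].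

(* The series \sum_i a_i(x) t^i X_i. *)
Definition path_field (a : nat -> cfun) (x : R) : ncseries R :=
  fun w => if w is [:: i] then a i x else 0.

(* [F] is the solution F_a on [0, T] of F' = (\sum_i a_i t^i X_i) F, F(0) = I;
   as the a_i are only defined almost everywhere, so is the equation. *)
Definition is_path_solution (a : nat -> cfun) (F : R -> G) : Prop :=
  [/\ F 0 = 1%g,
      (forall w, exists K : R, forall x y : R, x \in `[0, T] -> y \in `[0, T] ->
        ComplexField.Normc.normc (\val (F x) w - \val (F y) w) <= K * `|x - y|)
    & {ae mu, forall x : R, x \in `[0, T] -> forall w,
        is_cderive (fun y => \val (F y) w) x
          ((path_field a x * \val (F x) : ncseries R) w)}].

(* The graph of the map E : a |-> F_a(T). *)
Definition path_endpoint (a : nat -> cfun) (g : G) : Prop :=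
  exists2 F, is_path_solution a F & g = F T.

Definition path_group : set G :=
  [set g | exists2 a, path_space a & path_endpoint a g].

Definition formal_path_group : set G := closure path_group.

Definition closed_path_group : set G :=
  [set g | exists2 a, closed_path_space a & path_endpoint a g].

Definition formal_closed_path_group : set G :=
  closure_in formal_path_group closed_path_group.

Definition primitive (f : cfun) (x : R) : R[i] := cintegral `[0, x] f.

(* The set P(X) of functions (a, x) |->
   (~a_(i_1)(x))^(n_1) ... (~a_(i_k)(x))^(n_k) a_j(x); [s] lists the pairs
   (i_l, n_l). *)
Definition path_integrand : set ((nat -> cfun) -> cfun) :=
  [set p | exists (s : seq (nat * nat)) (j : nat),
    p = fun a x => (\prod_(q <- s) primitive (a q.1) x ^+ q.2) * a j x].

(* For ps = [:: p_1; ...; p_k], the integral over 0 <= s_1 <= ... <= s_k <= x;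
   the last integrand p_k is the outermost one. *)
Definition iterated_integral (ps : seq ((nat -> cfun) -> cfun))
    (a : nat -> cfun) : cfun :=
  foldl (fun J p x => cintegral `[0, x] (fun s => p a s * J s)) (fun=> 1) ps.

Definition is_moment (k : nat) (m : (nat -> cfun) -> R[i]) : Prop :=
  (0 < k)%N /\ exists ps : k.-tuple ((nat -> cfun) -> cfun),
    (forall l, path_integrand (tnth ps l)) /\
    m = fun a => iterated_integral ps a T.

(* [mh] is the moment \hat m on the group of formal paths induced by some moment
   m of order k on the path space; only its values on [formal_path_group] are
   determined. *)
Definition is_formal_moment (k : nat) (mh : G -> R[i]^o) : Prop :=
  exists m, [/\ is_moment k m,
    {within formal_path_group, continuous mh}
    & forall a g, path_space a -> path_endpoint a g -> mh g = m a].

End Paths.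

(* Main.v *)
Require Import Defs.
From HB Require Import structures.
From mathcomp Require Import all_boot all_order all_algebra.
From mathcomp Require Import all_classical all_reals all_analysis.
From mathcomp Require Import measurable_realfun complex.
From mathcomp Require Import ring lra zify.
Set Implicit Arguments.
Unset Strict Implicit.
Unset Printing Implicit Defensive.
Import Order.TTheory GRing.Theory Num.Theory.
Import numFieldNormedType.Exports.
Local Open Scope classical_set_scope.
Local Open Scope ring_scope.
Local Open Scope complex_scope.

(* The endpoint of a path satisfies the shuffle relations, and a moment of a
   path is a sum of coefficients of its endpoint: with sigma_j the operator
   removing a leading letter X_j, and tau_i the derivation d/dX_i (adjoint to
   the shuffle product by X_i), the moment with integrands p_k, ..., p_1,
   p = ~a_(i_1) ... ~a_(i_r) a_j, is the constant term of D_(p_1) ... D_(p_k) g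
   where D_p = tau_(i_1) ... tau_(i_r) sigma_j.  Closed paths are killed by all
   the tau_i, and D_p (f g) = f_0 D_p g + (D_p f) g when all tau_i kill g; so
   on closed paths moments multiply like coefficients of a product, and those
   of order <= n vanish on the n-th term of the lower central series.

   Conversely, let g be a limit of closed paths whose moments of order <= n
   vanish.  An element h of the n-th term agreeing with g up to degree d is
   corrected in degree d+1: the difference P of the homogeneous components is
   killed by shuffles, hence is a Lie polynomial by Dynkin's formula, and its
   moments of order <= n vanish.  Let L be the free Lie algebra, L' = [L, L].
   Modulo [L', L'], Dynkin's formula expresses u in L' through its moments of
   order 1, u = Theta_1 u; multiplicativity of moments upgrades this to
   P = Theta_m P modulo the (m+1)-th term of the lower central series of L', for
   P in its m-th term and Theta_m a combination of moments of order m.  So P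
   lies in the (n+1)-th term, spanned by iterated brackets of elements of L',
   and is the leading term of a product of iterated commutators of closed
   piecewise constant paths. *)

(** * Moments and the lower central series *)

HB.lock Definition sig (R : realType) (j : nat) (f : ncseries R) : ncseries R :=
  fun w => f (j :: w).
Canonical sig_unlockable := Unlockable sig.unlock.

(* The coefficients of [f] summed over all shuffles of [u] and [v]. *)
Fixpoint sh (R : realType) (u : seq nat) : seq nat -> ncseries R -> R[i] :=
  if u is a :: u' then
    fix shu v f := if v is b :: v' then sh u' v (sig a f) + shu v' (sig b f)
                   else f u
  else fun v f => f v.

(* The derivation d/dX_i, adjoint to the shuffle product by the letter [i]. *)
HB.lock Definition tau (R : realType) (i : nat) (f : ncseries R) : ncseries R :=
  fun w => sh [:: i] w f.
Canonical tau_unlockable := Unlockable tau.unlock.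

Section SeriesAlgebra.
Variable R : realType.
Local Notation A := (ncseries R).
Implicit Types (f g h : A) (w u v : seq nat) (c : R[i]).

Definition ncscale c f : A := fun w => c * f w.

Fact ncscaleA a b f : ncscale a (ncscale b f) = ncscale (a * b) f.
Proof. by apply/funext => w; rewrite /ncscale mulrA. Qed.
Fact ncscale1 : left_id 1 ncscale.
Proof. by move=> f; apply/funext => w; rewrite /ncscale mul1r. Qed.
Fact ncscaleDr : right_distributive ncscale +%R.
Proof. by move=> a f g; apply/funext => w; rewrite [LHS]mulrDr. Qed.
Fact ncscaleDl f : {morph ncscale^~ f : a b / a + b}.
Proof. by move=> a b; apply/funext => w; rewrite [LHS]mulrDl. Qed.

HB.instance Definition _ := GRing.Zmodule_isLmodule.Build R[i] (ncseries R)
  ncscaleA ncscale1 ncscaleDr ncscaleDl.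

Lemma ncmulE f g w :
  (f * g : A) w = \sum_(i < (size w).+1) f (take i w) * g (drop i w).
Proof. by []. Qed.

Fact ncscaleAl c f g : c *: (f * g) = (c *: f) * g :> A.
Proof.
apply/funext => w; rewrite [LHS]big_distrr; apply: eq_bigr => i _ /=.
by rewrite [RHS]/GRing.mul/= mulrA.
Qed.
Fact ncscaleAr c f g : c *: (f * g) = f * (c *: g) :> A.
Proof.
apply/funext => w; rewrite [LHS]big_distrr; apply: eq_bigr => i _ /=.
by rewrite mulrCA.
Qed.

HB.instance Definition _ := GRing.Lmodule_isLalgebra.Build R[i] (ncseries R)
  ncscaleAl.
HB.instance Definition _ := GRing.Lalgebra_isAlgebra.Build R[i] (ncseries R)
  ncscaleAr.

Lemma ncaddE f g w : (f + g : A) w = f w + g w. Proof. by []. Qed.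
Lemma ncoppE f w : (- f : A) w = - f w. Proof. by []. Qed.
Lemma ncscaleE c f w : (c *: f : A) w = c * f w. Proof. by []. Qed.
Lemma nconeE w : (1 : A) w = (w == [::])%:R. Proof. by []. Qed.
Lemma nczeroE w : (0 : A) w = 0. Proof. by []. Qed.
Lemma ncsumE (I : Type) (r : seq I) (P : pred I) (F : I -> A) w :
  (\sum_(i <- r | P i) F i) w = \sum_(i <- r | P i) F i w.
Proof. by elim/big_rec2: _ => // i y z _ <-. Qed.

Lemma ncmul0E f g : (f * g : A) [::] = f [::] * g [::].
Proof. by rewrite ncmulE big_ord_recl big_ord0 addr0. Qed.

Lemma sigE i f w : sig i f w = f (i :: w).
Proof. by rewrite unlock. Qed.

Fact sig_is_linear j : linear (sig j).
Proof. by rewrite unlock. Qed.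
HB.instance Definition _ j :=
  GRing.isLinear.Build R[i] A A _ (sig j) (sig_is_linear j).

Lemma sig_mul j f g : sig j (f * g) = f [::] *: sig j g + sig j f * g.
Proof.
by rewrite unlock; apply/funext => w;
  rewrite [LHS]/(ncmul _ _ _) /ncmul big_ord_recl.
Qed.

Lemma sig1 j : sig j 1 = 0 :> A.
Proof. by rewrite unlock. Qed.

Lemma sh0s v f : sh [::] v f = f v. Proof. by []. Qed.
Lemma shs0 u f : sh u [::] f = f u. Proof. by case: u. Qed.
Lemma sh_cons a u b v f :
  sh (a :: u) (b :: v) f = sh u (b :: v) (sig a f) + sh (a :: u) v (sig b f).
Proof. by []. Qed.

Lemma shP c u v f g : sh u v (c *: f + g) = c * sh u v f + sh u v g.
Proof.
elim: u v f g => [//|a u IHu] v; elim: v => [//|b v IHv] f g.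
by rewrite !sh_cons !linearP IHu IHv; ring.
Qed.

Lemma shB u v f g : sh u v (f - g) = sh u v f - sh u v g.
Proof. by rewrite -scaleN1r addrC shP; ring. Qed.

(** Shuffles of [u] and [v] are rearrangements of [u ++ v], so no other coefficients are read. *)
Lemma sh_ext u v f g :
  (forall w, perm_eq w (u ++ v) -> f w = g w) -> sh u v f = sh u v g.
Proof.
elim: u v f g => [|a u IHu] v; first by move=> f g; apply.
elim: v => [|b v IHv] f g fg; first by rewrite !shs0 fg// cats0.
rewrite !sh_cons; congr (_ + _).
  by apply: IHu => w wuv; rewrite !sigE; apply: fg; rewrite cat_cons perm_cons.
apply: IHv => w wuv; rewrite !sigE; apply: fg.
by rewrite -[b :: v]cat1s perm_sym perm_catCA /= perm_sym perm_cons.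
Qed.

Fact tau_is_linear i : linear (tau i).
Proof. by move=> c f g; apply/funext => w; rewrite unlock shP. Qed.
HB.instance Definition _ i :=
  GRing.isLinear.Build R[i] A A _ (tau i) (tau_is_linear i).

Lemma tau0E i f : tau i f [::] = f [:: i].
Proof. by rewrite unlock. Qed.

Lemma tauE i f w : tau i f w = sh [:: i] w f.
Proof. by rewrite unlock. Qed.

(** The inserted letter [i] lands either in front of the letter [j] or somewhere behind it. *)
Lemma sig_tau i j f : sig j (tau i f) = sig j (sig i f) + tau i (sig j f).
Proof. by apply/funext => w; rewrite sigE !tauE ncaddE tauE sh_cons sigE. Qed.

(** The Leibniz rule: a letter inserted in a word cut in two goes into one of the two pieces. The
    induction peels leading letters with [sig_mul] and [sig_tau]. *)
Lemma tau_mul i f g : tau i (f * g) = tau i f * g + f * tau i g.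
Proof.
apply/funext => w; elim: w f g => [|b w IH] f g.
  rewrite tau0E -sigE sig_mul !ncaddE !ncmul0E ncscaleE.
  by rewrite !tau0E !sigE addrC.
rewrite -!sigE.
rewrite sig_tau !linearD /= !sig_mul !linearD !linearZ /= !sig_mul.
rewrite !sig_tau tau0E -sigE mulrDl scalerDr.
by rewrite !(ncaddE, IH, ncscaleE); ring.
Qed.

Lemma tau1 i : tau i 1 = 0 :> A.
Proof.
apply/funext => -[|b w]; first by rewrite tau0E.
by rewrite -!sigE sig_tau !sig1 !linear0 addr0.
Qed.

(** The operator [D_p] of an integrand: [p.1] lists the primitives with repetition, [p.2] is the
    index of the last factor. *)
Definition momop (p : seq nat * nat) f : A :=
  foldl (fun x i => tau i x) (sig p.2 f) p.1.

Fact foldl_tau_is_linear s : linear (fun f => foldl (fun x i => tau i x) f s).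
Proof. by elim: s => [//|i s IH] c f g /=; rewrite linearP IH. Qed.

Fact momop_is_linear p : linear (momop p).
Proof. by move=> c f g; rewrite /momop linearP foldl_tau_is_linear. Qed.
HB.instance Definition _ p :=
  GRing.isLinear.Build R[i] A A _ (momop p) (momop_is_linear p).

(* [mom qs g] is the value at [g] of the moment whose integrands, outermost
   first, are x |-> (\prod_(i <- q.1) ~a_i(x)) * a_(q.2)(x) for [q <- qs]. *)
Fixpoint mom (qs : seq (seq nat * nat)) f : R[i] :=
  if qs is q :: qs' then mom qs' (momop q f) else f [::].

Lemma momP qs c f g : mom qs (c *: f + g) = c * mom qs f + mom qs g.
Proof. by elim: qs f g => [//|q qs IH] f g /=; rewrite linearP IH. Qed.

Lemma mom0 qs : mom qs (0 : A) = 0.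
Proof. by elim: qs => //= q qs IH; rewrite linear0. Qed.
Lemma momD qs f g : mom qs (f + g) = mom qs f + mom qs g.
Proof. by rewrite -[f]scale1r momP mul1r scale1r. Qed.
Lemma momZ qs c f : mom qs (c *: f) = c * mom qs f.
Proof. by rewrite -[c *: f]addr0 momP mom0 addr0. Qed.
Lemma momN qs f : mom qs (- f) = - mom qs f.
Proof. by rewrite -scaleN1r momZ mulN1r. Qed.
Lemma momB qs f g : mom qs (f - g) = mom qs f - mom qs g.
Proof. by rewrite momD momN. Qed.

Lemma momop1 q : momop q 1 = 0 :> A.
Proof.
by rewrite /momop sig1; elim: q.1 => //= i s IH; rewrite linear0.
Qed.

Lemma mom1 qs : (0 < size qs)%N -> mom qs (1 : A) = 0.
Proof. by case: qs => //= q qs _; rewrite momop1 mom0. Qed.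

(** For a series satisfying the shuffle relations this amounts to the vanishing of the linear
    coefficients, the closing condition for paths. *)
Definition nc_closed f := forall i, tau i f = 0.

(** [sig] acts either on [g], leaving the constant term of [f], or on [f]; in the second case the
    derivations [tau] pass [g], which they kill. *)
Lemma momop_mul q f g : nc_closed g ->
  momop q (f * g) = f [::] *: momop q g + momop q f * g.
Proof.
move=> g0; rewrite /momop sig_mul; move: (sig _ f) (sig _ g).
elim: q.1 => [//|i s IH] f' g' /=.
by rewrite linearP /= tau_mul g0 mulr0 addr0 IH.
Qed.

(** By [momop_mul] the operators act on [f] until one acts on [g], and all later ones stay there;
    hence the sum over the cuts of [qs]. *)
Lemma mom_mul qs f g : nc_closed g -> mom qs (f * g) =
  \sum_(k < (size qs).+1) mom (take k qs) f * mom (drop k qs) g.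
Proof.
move=> g0; elim: qs f => [|q qs IH] f.
  by rewrite big_ord_recl big_ord0 addr0 /= ncmul0E.
by rewrite [LHS]/= momop_mul// momP IH [RHS]big_ord_recl.
Qed.

(** The empty list is allowed, so the constant term vanishes too; for a group element [x] the
    condition is put on [x - 1]. *)
Definition mom_vanish n f := forall qs, (size qs <= n)%N -> mom qs f = 0.

(** In each cut of [mom_mul] either at most [m] operators act on [f], or at most [n] are left for
    [g]. *)
Lemma mom_vanish_mul m n f g : nc_closed g ->
  mom_vanish m f -> mom_vanish n g -> mom_vanish (m + n).+1 (f * g).
Proof.
move=> g0 fm gn qs qsmn; rewrite mom_mul// big1// => k _.
have [km|km] := leqP (size (take k qs)) m; first by rewrite fm// mul0r.
rewrite [X in _ * X]gn ?mulr0//.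
have := ltn_ord k; rewrite ltnS => kq.
move: km; rewrite size_takel// size_drop; lia.
Qed.

Lemma mom_vanish_mull n f g : nc_closed g ->
  mom_vanish n g -> mom_vanish n (f * g).
Proof.
move=> g0 gn qs qsn; rewrite mom_mul// big1// => k _.
by rewrite [X in _ * X]gn ?mulr0// size_drop (leq_trans (leq_subr _ _)).
Qed.

Lemma mom_vanish_mulr n f g : nc_closed g ->
  mom_vanish n f -> mom_vanish n (f * g).
Proof.
move=> g0 fn qs qsn; rewrite mom_mul// big1// => k _.
by rewrite fn ?mul0r// size_take; case: ifP; lia.
Qed.

Lemma mom_vanishB n f g :
  mom_vanish n f -> mom_vanish n g -> mom_vanish n (f - g).
Proof. by move=> fn gn qs qsn; rewrite momB fn// gn// subrr. Qed.

Lemma nc_closed1 : nc_closed (1 : A). Proof. by move=> i; rewrite tau1. Qed.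
Lemma nc_closedB f g : nc_closed f -> nc_closed g -> nc_closed (f - g).
Proof. by move=> f0 g0 i; rewrite linearB /= f0 g0 subrr. Qed.
Lemma nc_closedM f g : nc_closed f -> nc_closed g -> nc_closed (f * g).
Proof. by move=> f0 g0 i; rewrite tau_mul f0 g0 mulr0 mul0r addr0. Qed.

End SeriesAlgebra.

(** * Moments of group commutators *)

Section MomentFiltration.
Variable R : realType.
Local Notation A := (ncseries R).
Local Notation G := (ncgroup R).
Implicit Types x y : G.

Lemma ncval1 : \val (1%g : G) = 1 :> A. Proof. by []. Qed.
Lemma ncvalM x y : \val (x * y)%g = \val x * \val y :> A. Proof. by []. Qed.
Lemma ncval_nil x : (\val x : A) [::] = 1.
Proof. by case: x => x /= /set_mem. Qed.
Lemma ncvalVM x : \val (x^-1)%g * \val x = 1 :> A.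
Proof. by rewrite -ncvalM mulVg. Qed.
Lemma ncvalMV x : \val x * \val (x^-1)%g = 1 :> A.
Proof. by rewrite -ncvalM mulgV. Qed.

(** A group commutator becomes, up to an invertible factor, the algebra commutator of [x - 1] and
    [y - 1], to which bounds on products apply. *)
Lemma ncval_comm x y : \val [~ x, y]%g - 1 = \val (x^-1)%g * \val (y^-1)%g *
  ((\val x - 1) * (\val y - 1) - (\val y - 1) * (\val x - 1)) :> A.
Proof.
have -> : (\val x - 1) * (\val y - 1) - (\val y - 1) * (\val x - 1) =
    \val x * \val y - \val y * \val x :> A.
  have sub1M (u v : A) : (u - 1) * (v - 1) = u * v - (u + v - 1).
    by rewrite mulrBl mulrBr mul1r mulr1 !opprD !opprK !addrA.
  by rewrite !sub1M [\val y + _]addrC; move: (_ - 1) => s;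
    rewrite opprB addrA subrK.
rewrite mulrBr; congr (_ - _).
  by rewrite /commg /conjg !ncvalM !mulrA.
by rewrite mulrA -(mulrA (\val x^-1)%g) ncvalVM mulr1 ncvalVM.
Qed.

Definition mom_filtration n : set G :=
  [set x | nc_closed (\val x : A) /\ mom_vanish n (\val x - 1 : A)].

(** Apply the derivation [tau i] to the identity expressing that [x^-1] is a left inverse of [x]. *)
Lemma nc_closedV x : nc_closed (\val x : A) -> nc_closed (\val (x^-1)%g : A).
Proof.
move=> x0 i; have := congr1 (tau i) (ncvalVM x).
rewrite tau_mul x0 mulr0 addr0 tau1 => /(congr1 (fun f => f * \val (x^-1)%g)).
by rewrite -mulrA ncvalMV mulr1 mul0r.
Qed.

Lemma mom_filtration_subgroup n : is_subgroup (mom_filtration n).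
Proof.
split.
- by split; [exact: nc_closed1 | move=> qs _; rewrite subrr mom0].
- move=> x y [x0 xn] [y0 yn]; split; first by rewrite ncvalM; exact: nc_closedM.
  have -> : \val (x * y)%g - 1 = (\val x - 1) * \val y - (1 - \val y) :> A.
    by rewrite ncvalM mulrBl mul1r opprB addrA subrK.
  apply: mom_vanishB; first exact: mom_vanish_mulr.
  by move=> qs /yn; rewrite -opprB momN => /eqP; rewrite oppr_eq0 => /eqP.
- move=> x [x0 xn]; have xV0 := nc_closedV x0; split=> //.
  have -> : \val (x^-1)%g - 1 = 0 - \val (x^-1)%g * (\val x - 1) :> A.
    by rewrite mulrBr ncvalVM mulr1 sub0r opprB.
  apply: mom_vanishB; first by move=> qs _; rewrite mom0.
  by apply: mom_vanish_mull => //; apply: nc_closedB => //; exact: nc_closed1.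
Qed.

Lemma mom_filtration_comm m n x y :
  mom_filtration m x -> mom_filtration n y ->
  mom_filtration (m + n).+1 [~ x, y]%g.
Proof.
move=> [x0 xm] [y0 yn].
have [xV0 yV0] := (nc_closedV x0, nc_closedV y0).
split; first by rewrite /commg /conjg !ncvalM; do !apply: nc_closedM.
have x10 := nc_closedB x0 (@nc_closed1 R).
have y10 := nc_closedB y0 (@nc_closed1 R).
rewrite ncval_comm; apply: mom_vanish_mull.
  by apply: nc_closedB; apply: nc_closedM.
apply: mom_vanishB; first exact: mom_vanish_mul.
by rewrite addnC; exact: mom_vanish_mul.
Qed.

(** Constant term 1 puts [K] in filtration 0, and a commutator with an element of filtration 0
    raises the order by one. *)
Lemma lower_central_moments (K : set G) n :
  (forall x, K x -> nc_closed (\val x : A)) ->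
  lower_central K n `<=` mom_filtration n.
Proof.
move=> K0.
have KF x : K x -> mom_filtration 0 x.
  by move=> /K0 x0; split=> // -[]// _; rewrite /= ncaddE ncval_nil subrr.
case: n => [//|n]; elim: n => [|n IH] x; apply => //; split;
  try exact: mom_filtration_subgroup.
  by move=> z [a [b [aK bK ->]]]; apply: (@mom_filtration_comm 0 0); apply: KF.
move=> z [a [b [aK bK ->]]]; apply: (@mom_filtration_comm 0 n.+1);
  [exact: KF | exact: IH].
Qed.

End MomentFiltration.

(** * Lie polynomials *)

Section LieSeries.
Variables (R : realType) (N : nat).
Local Notation A := (ncseries R).
Implicit Types (f g u v P : A) (w : seq nat) (c : R[i]).

Definition ncvar i : A := fun w => (w == [:: i])%:R.

Lemma sig_ncvar i j : sig i (ncvar j) = (i == j)%:R *: 1.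
Proof.
apply/funext => w; rewrite sigE ncscaleE nconeE /ncvar eqseq_cons.
by case: eqP; rewrite ?mul1r ?mul0r.
Qed.

Lemma tau_scale1 i c : tau i (c *: 1) = 0 :> A.
Proof. by rewrite linearZ /= tau1 scaler0. Qed.

Lemma tau_ncvar i j : tau i (ncvar j) = (i == j)%:R *: 1.
Proof.
apply/funext => -[|b w].
  by rewrite tau0E ncscaleE nconeE eqxx mulr1 /ncvar eqseq_cons andbT.
rewrite -!sigE sig_tau !sig_ncvar linearZ /= sig1 scaler0 add0r.
by rewrite tau_scale1.
Qed.

Definition brk u v : A := u * v - v * u.

Lemma brkPl x c u v : brk (c *: u + v) x = c *: brk u x + brk v x.
Proof.
rewrite /brk mulrDl mulrDr -scalerAl -scalerAr; apply/funext => w.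
by rewrite !(ncaddE, ncoppE, ncscaleE); ring.
Qed.
Lemma brkC u v : brk u v = - brk v u.
Proof. by rewrite /brk opprB. Qed.
Lemma brkPr x c u v : brk x (c *: u + v) = c *: brk x u + brk x v.
Proof. by rewrite brkC brkPl opprD -scalerN -!brkC. Qed.
Lemma brkBl x u v : brk (u - v) x = brk u x - brk v x.
Proof. by rewrite addrC -scaleN1r brkPl scaleN1r addrC. Qed.
Lemma brkBr x u v : brk x (u - v) = brk x u - brk x v.
Proof. by rewrite addrC -scaleN1r brkPr scaleN1r addrC. Qed.
Lemma brk0l u : brk 0 u = 0.
Proof. by rewrite /brk mul0r mulr0 subr0. Qed.
Lemma brk0r u : brk u 0 = 0.
Proof. by rewrite /brk mul0r mulr0 subr0. Qed.
Lemma brkZl c u v : brk (c *: u) v = c *: brk u v.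
Proof. by rewrite -[c *: u]addr0 brkPl brk0l addr0. Qed.

Lemma jacobi u v x : brk u (brk v x) = brk (brk u v) x + brk v (brk u x).
Proof.
rewrite /brk !mulrBl !mulrBr !mulrA; apply/funext => w.
by rewrite !(ncaddE, ncoppE); ring.
Qed.

(* [lie 0 d] consists of the Lie polynomials of degree [d.+1] in the first [N]
   variables, [lie 1 d] of those in L' = [L, L], and [lie k.+1 d] of those in
   the (k+1)-th term of the lower central series of L', the first being L'. *)
Inductive lie : nat -> nat -> A -> Prop :=
| lie_var i : (i < N)%N -> lie 0 0 (ncvar i)
| lie_brk d e u v : lie 0 d u -> lie 0 e v -> lie 1 (d + e).+1 (brk u v)
| lie_brkS k d e u v :
    lie 1 d u -> lie k.+1 e v -> lie k.+2 (d + e).+1 (brk u v)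
| lie_lin k d c u v : lie k d u -> lie k d v -> lie k d (c *: u + v)
| lie_zero k d : lie k d 0
| lie_sub k d u : lie k.+1 d u -> lie k d u.

Lemma lie_deg k d e u : d = e -> lie k d u -> lie k e u.
Proof. by move=> ->. Qed.
Lemma lieD k d u v : lie k d u -> lie k d v -> lie k d (u + v).
Proof. by move=> uk vk; rewrite -[u]scale1r; exact: lie_lin. Qed.
Lemma lieZ k d c u : lie k d u -> lie k d (c *: u).
Proof.
by move=> uk; rewrite -[_ *: _]addr0; apply: lie_lin => //; exact: lie_zero.
Qed.
Lemma lieN k d u : lie k d u -> lie k d (- u).
Proof. by rewrite -scaleN1r; exact: lieZ. Qed.
Lemma lieB k d u v : lie k d u -> lie k d v -> lie k d (u - v).
Proof. by move=> uk vk; apply: lieD => //; exact: lieN. Qed.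
Lemma lie_sum k d (I : Type) (r : seq I) (F : I -> A) :
  (forall i, lie k d (F i)) -> lie k d (\sum_(i <- r) F i).
Proof.
by move=> Fk; elim/big_rec: _ => [|i x _ xk]; [exact: lie_zero | exact: lieD].
Qed.

(** Bracketing with [u] is a derivation by the Jacobi identity and preserves L', hence also every
    term of the lower central series of L'. *)
Lemma lie_ideal k d e u v :
  lie 0 d u -> lie k.+1 e v -> lie k.+1 (d + e).+1 (brk u v).
Proof.
move=> ud vk; move: vk (ltn0Sn k); move: k.+1 => {}k vk k0.
elim: k e v / vk k0 d u ud => //.
- move=> d1 d2 a b ad _ bd _ _ d u ud.
  by apply: lie_brk => //; apply: lie_sub; exact: lie_brk.
- move=> k d1 d2 a b ad _ bd IHb _ d u ud; rewrite jacobi; apply: lieD.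
    apply: (@lie_deg _ ((d + d1).+1 + d2).+1); first by lia.
    by apply: lie_brkS => //; apply: lie_brk => //; exact: lie_sub.
  apply: (@lie_deg _ (d1 + (d + d2).+1).+1); first by lia.
  by apply: lie_brkS => //; exact: IHb.
- move=> k e c a b _ IHa _ IHb k0 d u ud; rewrite brkPr.
  by apply: lie_lin; [exact: IHa | exact: IHb].
- by move=> k e _ d u _; rewrite brk0r; exact: lie_zero.
- by move=> k e v' _ IH k0 d u ud; apply: lie_sub; exact: IH.
Qed.

(** Induction on the left entry: the Jacobi identity turns a bracket with [brk a b] into brackets
    with [b] and then [a], in both orders. *)
Lemma lie_brkD j k d e u v :
  lie j.+1 d u -> lie k.+1 e v -> lie (j.+1 + k.+1) (d + e).+1 (brk u v).
Proof.
move=> uj; move: uj (ltn0Sn j); move: j.+1 => {}j uj j0.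
elim: j d u / uj j0 k e v => //.
- move=> d1 d2 a b ad _ bd _ _ k e v vk.
  by rewrite add1n; apply: lie_brkS => //; exact: lie_brk.
- move=> j d1 d2 a b ad _ bd IHb _ k e v vk.
  have -> : brk (brk a b) v = brk a (brk b v) - brk b (brk a v).
    by rewrite [in RHS]jacobi addrK.
  apply: lieB.
    apply: (@lie_deg _ (d1 + (d2 + e).+1).+1); first by lia.
    by apply: lie_brkS => //; exact: IHb.
  apply: (@lie_deg _ (d2 + (d1 + e).+1).+1); first by lia.
  rewrite addSnnS; apply: IHb => //.
  exact: lie_brkS.
- move=> j d c a b _ IHa _ IHb j0 k e v vk; rewrite brkPl.
  by apply: lie_lin; [exact: IHa | exact: IHb].
- by move=> j d _ k e v vk; rewrite brk0l; exact: lie_zero.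
- by move=> j d u' _ IH j0 k e v vk; apply: lie_sub; exact: IH.
Qed.

Definition letters w := all (fun i => i < N)%N w.

(** Degree is word length, not the power of [t]; the bound on the letters leaves finitely many words
    in each degree. *)
Definition nchomog (d : nat) f :=
  forall w, ~~ ((size w == d) && letters w) -> f w = 0.

Lemma nchomogM d e f g : nchomog d f -> nchomog e g -> nchomog (d + e) (f * g).
Proof.
move=> fd ge w wde; rewrite ncmulE big1// => k _.
have [/andP[/eqP sd ld]|/fd ->] :=
  boolP ((size (take k w) == d) && letters (take k w)); last by rewrite mul0r.
rewrite ge ?mulr0//; apply: contra wde => /andP[/eqP se le].
rewrite -{1 2}(cat_take_drop k w) size_cat sd se eqxx /letters all_cat.
by rewrite -!/(letters _) ld.
Qed.

Lemma nchomogP d c f g : nchomog d f -> nchomog d g -> nchomog d (c *: f + g).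
Proof. by move=> fd gd w wd; rewrite ncaddE ncscaleE fd// gd// mulr0 addr0. Qed.

Lemma nchomog_brk d e f g :
  nchomog d f -> nchomog e g -> nchomog (d + e) (brk f g).
Proof.
move=> fd ge w wd; have wd2 := wd; rewrite addnC in wd2;
  rewrite /brk ncaddE ncoppE.
by rewrite (nchomogM fd ge)// (nchomogM ge fd)// subr0.
Qed.

Lemma lie_homog k d u : lie k d u -> nchomog d.+1 u.
Proof.
elim=> {k d u}.
- move=> i iN w; apply: contraNeq; rewrite /ncvar pnatr_eq0 eqb0 negbK.
  by move=> /eqP ->; rewrite /letters /= iN.
- by move=> d e u v _ ud _ ve; rewrite -addnS -addSn; exact: nchomog_brk.
- by move=> k d e u v _ ud _ ve; rewrite -addnS -addSn; exact: nchomog_brk.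
- by move=> k d c u v _ ud _ vd; exact: nchomogP.
- by [].
- by [].
Qed.

Lemma lie_nil k d u : lie k d u -> u [::] = 0.
Proof. by move=> /lie_homog ->. Qed.

(** Brackets kill scalars, so a derivation with scalar values on L vanishes on brackets. The two
    claims are proved together because the second on a bracket uses the first on its entries. *)
Lemma lie_tau k d u : lie k d u ->
  (forall i, exists c, tau i u = c *: 1) /\ ((0 < k)%N -> nc_closed u).
Proof.
have tau_brk i (f g : A) : tau i (brk f g) = brk (tau i f) g + brk f (tau i g).
  rewrite /brk linearB /= !tau_mul; apply/funext => w.
  by rewrite !(ncaddE, ncoppE); ring.
have brk1l c f : brk (c *: 1) f = 0.
  by rewrite brkZl /brk mul1r mulr1 subrr scaler0.
have brk1r c f : brk f (c *: 1) = 0 by rewrite brkC brk1l oppr0.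
elim=> {k d u}.
- by move=> i iN; split=> // j; exists (j == i)%:R; rewrite tau_ncvar.
- move=> d e u v _ [uc _] _ [vc _].
  have uv0 : nc_closed (brk u v).
    move=> i; rewrite tau_brk; case: (uc i) => a ->; case: (vc i) => b ->.
    by rewrite brk1l brk1r addr0.
  by split=> // i; exists 0; rewrite uv0 scale0r.
- move=> k d e u v _ [_ u0] _ [_ v0].
  have uv0 : nc_closed (brk u v).
    by move=> i; rewrite tau_brk u0// v0// brk0l brk0r addr0.
  by split=> // i; exists 0; rewrite uv0 scale0r.
- move=> k d c u v _ [uc u0] _ [vc v0]; split.
    move=> i; have [a ua] := uc i; have [b vb] := vc i; exists (c * a + b).
    by rewrite linearP /= ua vb scalerA -scalerDl.
  by move=> k0 i; rewrite linearP /= u0// v0// scaler0 addr0.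
- move=> k d; split => [i|_ i]; last by rewrite linear0.
  by exists 0; rewrite linear0 scale0r.
- by move=> k d u _ [uc u0]; split=> // _; exact: u0.
Qed.

Lemma lie_closed k d u : lie k.+1 d u -> nc_closed u.
Proof. by case/lie_tau => _; apply. Qed.

(** The linear extension of [b] from words of length [d] in the first [N] letters, by recursion on
    the leading letter so as to match [sig]. *)
Fixpoint wsum d (b : seq nat -> A) f : A :=
  if d is d'.+1 then \sum_(i < N) wsum d' (fun w => b (val i :: w)) (sig i f)
  else f [::] *: b [::].

Lemma wsumS d b f :
  wsum d.+1 b f = \sum_(i < N) wsum d (fun w => b (val i :: w)) (sig i f).
Proof. by []. Qed.

Lemma wsumP d b c f g : wsum d b (c *: f + g) = c *: wsum d b f + wsum d b g.
Proof.
elim: d b f g => [|d IH] b f g /=.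
  by rewrite ncaddE ncscaleE scalerDl scalerA.
by rewrite scaler_sumr -big_split; apply: eq_bigr => i _; rewrite linearP IH.
Qed.
Lemma wsum0 d b : wsum d b 0 = 0.
Proof.
elim: d b => [|d IH] b /=; first by rewrite nczeroE scale0r.
by rewrite big1// => i _; rewrite linear0 IH.
Qed.
Lemma wsumZ d b c f : wsum d b (c *: f) = c *: wsum d b f.
Proof. by rewrite -[c *: f]addr0 wsumP wsum0 addr0. Qed.
Lemma wsumD d b f g : wsum d b (f + g) = wsum d b f + wsum d b g.
Proof. by rewrite -[f]scale1r wsumP !scale1r. Qed.
Lemma wsumN d b f : wsum d b (- f) = - wsum d b f.
Proof. by rewrite -scaleN1r wsumZ scaleN1r. Qed.
Lemma wsum_lin (phi : A -> A) d b f :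
  (forall c x y, phi (c *: x + y) = c *: phi x + phi y) ->
  wsum d (fun w => phi (b w)) f = phi (wsum d b f).
Proof.
move=> phiP; have phi0 : phi 0 = 0.
  by have := phiP (-1) 0 0; rewrite addr0 scaler0 scaleN1r addNr.
have phiD x y : phi (x + y) = phi x + phi y.
  by rewrite -[x]scale1r phiP !scale1r.
elim: d b f => [|d IH] b f /=.
  by rewrite -[_ *: b _]addr0 phiP phi0 addr0.
rewrite (big_morph phi phiD phi0); apply: eq_bigr => i _; exact: IH.
Qed.

Lemma wsum_mod k e d b b' f :
  (forall w, size w = d -> letters w -> lie k e (b w - b' w)) ->
  lie k e (wsum d b f - wsum d b' f).
Proof.
elim: d b b' f => [|d IH] b b' f bb' /=.
  by rewrite -scalerBr; apply: lieZ; exact: bb'.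
rewrite -sumrB; apply: lie_sum => i; apply: IH => w wd wN; apply: bb' => /=.
  by rewrite wd.
by rewrite ltn_ord.
Qed.

Lemma eq_wsum d b b' f :
  (forall w, size w = d -> b w = b' w) -> wsum d b f = wsum d b' f.
Proof.
elim: d b b' f => [|d IH] b b' f bb' /=; first by rewrite bb'.
by apply: eq_bigr => i _; apply: IH => w wd; apply: bb'; rewrite /= wd.
Qed.

Lemma wsumS1 d b : wsum d.+1 b 1 = 0.
Proof. by rewrite /= big1// => i _; rewrite sig1 wsum0. Qed.

(** Only words ending in [j] have a nonzero coefficient in a product with [ncvar j] on the right. *)
Lemma wsum_mulvar d b f j : (j < N)%N ->
  wsum d.+1 b (f * ncvar j) = wsum d (fun w => b (rcons w j)) f.
Proof.
move=> jN; elim: d b f => [|d IH] b f.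
  rewrite /= (bigD1 (Ordinal jN))//= big1 ?addr0.
    by rewrite sig_mul sig_ncvar eqxx ncaddE !ncscaleE nconeE ncmul0E !mulr1
      /ncvar /= mulr0 addr0.
  move=> i ij; rewrite sig_mul sig_ncvar ncaddE !ncscaleE ncmul0E /ncvar /=.
  have /negPf -> : val i != j by [].
  by rewrite mul0r !mulr0 addr0 scale0r.
rewrite [LHS]wsumS [RHS]wsumS; apply: eq_bigr => i _; rewrite sig_mul sig_ncvar.
by rewrite wsumD !wsumZ wsumS1 !scaler0 add0r IH.
Qed.

(** Left-normed brackets, starting from an arbitrary first entry [u] or from the first letter of the
    word; [lbr] of the empty word is a default value. *)
Definition lbr_from u w : A := foldl (fun x j => brk x (ncvar j)) u w.
Definition lbr w : A := if w is i :: w' then lbr_from (ncvar i) w' else 0.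

Lemma lbr_from_cons u i w :
  lbr_from u (i :: w) = lbr_from (brk u (ncvar i)) w.
Proof. by []. Qed.

Lemma lbr_from_cat u w1 w2 :
  lbr_from u (w1 ++ w2) = lbr_from (lbr_from u w1) w2.
Proof. exact: foldl_cat. Qed.

Lemma lbr_cons2 i j w :
  lbr [:: i, j & w] = lbr_from (brk (ncvar i) (ncvar j)) w.
Proof. by []. Qed.

Lemma lbr_from_rcons u w j : lbr_from u (rcons w j) = brk (lbr_from u w) (ncvar j).
Proof. by rewrite /lbr_from foldl_rcons. Qed.

Lemma lbr_rcons w j : (0 < size w)%N -> lbr (rcons w j) = brk (lbr w) (ncvar j).
Proof. by case: w => //= i w _; exact: lbr_from_rcons. Qed.

Lemma lbr_fromB w u v : lbr_from (u - v) w = lbr_from u w - lbr_from v w.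
Proof. by elim: w u v => [//|i w IH] u v; rewrite !lbr_from_cons brkBl IH. Qed.

Lemma lie_lbr_from k d u w :
  lie k.+1 d u -> letters w -> lie k.+1 (d + size w) (lbr_from u w).
Proof.
elim: w d u => [|i w IH] d u uk /=; first by rewrite addn0.
move=> /andP[iN wN]; rewrite addnS -addSn; apply: IH => //.
rewrite brkC; apply: lieN; apply: (@lie_deg _ (0 + d).+1); first by lia.
by apply: lie_ideal => //; exact: lie_var.
Qed.

(* The left-normed Dynkin operator on series of degree [d.+1]. *)
Definition dynkin_sum d f : A := wsum d.+1 lbr f.

(** Right multiplication by a letter becomes right bracketing by it; the Jacobi identity extends
    this from letters to all Lie polynomials. *)
Lemma dynkin_mul k d e f P : lie k e P ->
  dynkin_sum (d + e.+1) (f * P) = brk (dynkin_sum d f) P.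
Proof.
move=> Pe; elim: k e P / Pe d f.
- move=> i iN d f; rewrite addn1 /dynkin_sum wsum_mulvar//.
  rewrite -[RHS](wsum_lin (phi := fun x => brk x (ncvar i))).
    by apply: eq_wsum => w wd; rewrite lbr_rcons// wd.
  by move=> c x y; rewrite brkPl.
- move=> d1 d2 a b _ IHa _ IHb d f; rewrite mulrBr !mulrA.
  rewrite /dynkin_sum -[_ - _]/(_ + - _) wsumD wsumN -!/(dynkin_sum _ _).
  have -> : (d + (d1 + d2).+2 = (d + d1.+1) + d2.+1)%N by lia.
  rewrite IHb IHa -addnA [(d1.+1 + _)%N]addnC addnA IHa IHb.
  by rewrite jacobi [brk a (brk _ b)]brkC.
- move=> k d1 d2 a b _ IHa _ IHb d f; rewrite mulrBr !mulrA.
  rewrite /dynkin_sum -[_ - _]/(_ + - _) wsumD wsumN -!/(dynkin_sum _ _).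
  have -> : (d + (d1 + d2).+2 = (d + d1.+1) + d2.+1)%N by lia.
  rewrite IHb IHa -addnA [(d1.+1 + _)%N]addnC addnA IHa IHb.
  by rewrite jacobi [brk a (brk _ b)]brkC.
- move=> k e c u v _ IHu _ IHv d f.
  by rewrite mulrDr -scalerAr /dynkin_sum wsumP -!/(dynkin_sum _ _) IHu IHv brkPr.
- by move=> k e d f; rewrite mulr0 brk0r; exact: wsum0.
- by move=> k e u _ IH d f; exact: IH.
Qed.

(** Dynkin's formula. By [dynkin_mul] the operator obeys the Leibniz rule on a bracket of Lie
    polynomials, so its eigenvalues, the degrees, add up. *)
Lemma dynkin_lie k d P : lie k d P -> dynkin_sum d P = d.+1%:R *: P.
Proof.
have dynkin_brk d1 d2 (a b : A) j k' : lie j d1 a -> lie k' d2 b ->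
    dynkin_sum d1 a = d1.+1%:R *: a -> dynkin_sum d2 b = d2.+1%:R *: b ->
    dynkin_sum (d1 + d2).+1 (brk a b) = (d1 + d2).+2%:R *: brk a b.
  move=> ad bd IHa IHb.
  rewrite /dynkin_sum /brk wsumD wsumN -!/(dynkin_sum _ _).
  rewrite -addnS (dynkin_mul _ _ bd) addnS addnC -addnS (dynkin_mul _ _ ad).
  rewrite IHa IHb !brkZl [brk b a]brkC scalerN opprK -scalerDl.
  by congr (_ *: _); rewrite -natrD; congr (_%:R); lia.
elim=> {k d P}.
- move=> i iN; rewrite /dynkin_sum -[ncvar i]mul1r wsum_mulvar//=.
  by rewrite nconeE eqxx !scale1r mul1r.
- move=> d e u v ud IHu ve IHv; exact: dynkin_brk ud ve IHu IHv.
- move=> k d e u v ud IHu ve IHv; exact: dynkin_brk ud ve IHu IHv.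
- move=> k d c u v _ IHu _ IHv.
  rewrite /dynkin_sum wsumP -!/(dynkin_sum _ _) IHu IHv scalerDr !scalerA.
  by rewrite mulrC.
- by move=> k d; rewrite scaler0; exact: wsum0.
- by [].
Qed.
End LieSeries.

(** * Moments of Lie polynomials *)

Section DynkinMoments.
Variables (R : realType) (N : nat).
Local Notation A := (ncseries R).
Local Notation ncvar := (@ncvar R).
Local Notation lbr := (@lbr R).
Local Notation lie := (@lie R N).
Local Notation wsum := (@wsum R N).
Local Notation letters := (letters N).
Implicit Types (f g u v P : A) (w : seq nat) (c : R[i]).

(* The sum of [c w *: b w] over the words [w] of length [d], where [c w] is the
   sum of [f w'] over the words [w'] obtained from [w] by the d! permutations of
   its letters. *)
Fixpoint tsum d (b : seq nat -> A) f : A :=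
  if d is d'.+1 then \sum_(i < N) tsum d' (fun w => b (val i :: w)) (tau i f)
  else f [::] *: b [::].

(** Invariance of [b] modulo [L', L'] under permutations of the letters, tested on adjacent
    transpositions. *)
Definition sym_mod d e (b : seq nat -> A) := forall s1 i j s2,
  (size s1 + size s2).+2 = d -> letters s1 -> letters s2 ->
  (i < N)%N -> (j < N)%N ->
  lie 2 e (b (s1 ++ [:: i, j & s2]) - b (s1 ++ [:: j, i & s2])).

Lemma sym_mod_cons d e b i : (i < N)%N ->
  sym_mod d.+1 e b -> sym_mod d e (fun w => b (i :: w)).
Proof.
move=> iN bS s1 k l s2 sd l1 l2 kN lN; apply: (bS (i :: s1)) => //=.
  by rewrite addSn sd.
by rewrite iN.
Qed.

(** [tau i] inserts [i] at each of [d.+1] places, and modulo [L', L'] all places count the same. *)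
Lemma wsum_tau d e b f : sym_mod d.+1 e b ->
  lie 2 e (\sum_(i < N) wsum d (fun w => b (val i :: w)) (tau i f)
           - d.+1%:R *: wsum d.+1 b f).
Proof.
elim: d b f => [|d IH] b f bS.
  rewrite scale1r wsumS -sumrB; apply: lie_sum => i /=.
  by rewrite tau0E sigE subrr; exact: lie_zero.
(* [W] collects the insertions of [i] in front of the word and [S2] those behind its first letter
   [j]. [S3] is [S2] with [j] and [i] exchanged in the argument of [b], the order to which the
   induction hypothesis applies. *)
set W := wsum d.+2 b f.
pose S2 := \sum_(j < N) \sum_(i < N)
  wsum d (fun w => b [:: val i, val j & w]) (tau i (sig j f)).
pose S3 := \sum_(j < N) \sum_(i < N)
  wsum d (fun w => b [:: val j, val i & w]) (tau i (sig j f)).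
have -> : \sum_(i < N) wsum d.+1 (fun w => b (val i :: w)) (tau i f) = W + S2.
  rewrite [S2]exchange_big /W [wsum _ _ f]wsumS -big_split.
  apply: eq_bigr => i _; rewrite !wsumS -big_split; apply: eq_bigr => j _.
  by rewrite sig_tau wsumD.
have -> : W + S2 - d.+2%:R *: W =
    (S2 - S3) + \sum_(j < N) (\sum_(i < N)
        wsum d (fun w => b [:: val j, val i & w]) (tau i (sig j f))
      - d.+1%:R *: wsum d.+1 (fun w => b (val j :: w)) (sig j f)).
  rewrite sumrB -/S3 -scaler_sumr -wsumS -/W addrA subrK -[d.+2]addn1 natrD.
  by rewrite scalerDl scale1r opprD addrA addrAC [W + S2]addrC addrK.
apply: lieD; last first.
  by apply: lie_sum => j; apply: IH; exact: (sym_mod_cons (ltn_ord _) bS).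
rewrite -sumrB; apply: lie_sum => j; rewrite -sumrB; apply: lie_sum => i.
apply: wsum_mod => w wd wN.
by apply: (bS [::]) => //=; rewrite add0n wd.
Qed.

(** One use of [wsum_tau] per letter; the factors multiply up to [d!]. *)
Lemma tsum_wsum d e b f : sym_mod d e b ->
  lie 2 e (tsum d b f - d`!%:R *: wsum d b f).
Proof.
elim: d b f => [|d IH] b f bS.
  by rewrite /= scale1r subrr; exact: lie_zero.
have -> : tsum d.+1 b f - d.+1`!%:R *: wsum d.+1 b f =
  \sum_(i < N) (tsum d (fun w => b (val i :: w)) (tau i f)
    - d`!%:R *: wsum d (fun w => b (val i :: w)) (tau i f))
  + d`!%:R *: (\sum_(i < N) wsum d (fun w => b (val i :: w)) (tau i f)
           - d.+1%:R *: wsum d.+1 b f).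
  rewrite sumrB -scaler_sumr scalerBr addrA subrK scalerA -natrM.
  by rewrite factS mulnC.
apply: lieD; last by apply: lieZ; exact: wsum_tau.
by apply: lie_sum => i; apply: IH; exact: (sym_mod_cons (ltn_ord _) bS).
Qed.

(** Index 0 means degree 1, while brackets have degree at least 2. *)
Lemma lie1_deg0 P : lie 1 0 P -> P = 0.
Proof.
suff gen k d f : lie k d f -> (0 < k)%N -> d = 0%N -> f = 0 by move/gen; apply.
elim=> {k d f} //.
- by move=> k d c u v _ IHu _ IHv k0 d0; rewrite IHu// IHv// scaler0 addr0.
- by move=> k d u _ IH _; exact: IH.
Qed.

Lemma tsumP d b c f g : tsum d b (c *: f + g) = c *: tsum d b f + tsum d b g.
Proof.
elim: d b f g => [|d IH] b f g /=.
  by rewrite ncaddE ncscaleE scalerDl scalerA.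
by rewrite scaler_sumr -big_split; apply: eq_bigr => i _; rewrite linearP IH.
Qed.
Lemma tsum0 d b : tsum d b 0 = 0.
Proof. by have := tsumP d b (-1) 0 0; rewrite scaler0 addr0 scaleN1r addNr. Qed.
Lemma tsumN d b f : tsum d b (- f) = - tsum d b f.
Proof. by rewrite -scaleN1r -[_ *: _]addr0 tsumP tsum0 addr0 scaleN1r. Qed.

(* On elements of [L, L], that is, when [tau l P = 0] for all [l], the
   coefficients P(ljw) symmetrized in [w] are the moments of order 1 with
   integrand ~a_l ~a_w a_j. *)
Lemma metabelian_dynkin d P : lie 1 d.+1 P ->
  lie 2 d.+1 (P - (- (d.+2 * d`!)%:R^-1) *:
    \sum_(l < N) \sum_(j < N)
      tsum d (fun w => lbr [:: val l, val j & w]) (tau l (sig j P))).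
Proof.
move=> P1; have P0 := lie_closed P1.
(* Since [P] is closed, removing its two leading letters is, up to sign, an operator of order 1;
   this is where the minus sign of the coefficient comes from. *)
have sigP l j : tau l (sig j P) = - sig j (sig l P).
  by apply/eqP; rewrite -addr_eq0 addrC -sig_tau P0 linear0.
(* [T] is the error made by symmetrizing all letters but the first two. By Dynkin's formula the
   unsymmetrized sum is [P] times the degree [d.+2], which together with [d!] gives the
   denominator. *)
pose T := \sum_(l < N) \sum_(j < N)
      (tsum d (fun w => lbr [:: val l, val j & w]) (sig j (sig l P))
       - d`!%:R *: wsum d (fun w => lbr [:: val l,
         val j & w]) (sig j (sig l P))).
have nz : (d.+2 * d`!)%:R != 0 :> R[i].
  by rewrite pnatr_eq0 -lt0n muln_gt0 fact_gt0.
have -> : P - (- (d.+2 * d`!)%:R^-1) *: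
    \sum_(l < N) \sum_(j < N)
      tsum d (fun w => lbr [:: val l, val j & w]) (tau l (sig j P))
    = - (d.+2 * d`!)%:R^-1 *: T.
  have -> : T = \sum_(l < N) \sum_(j < N)
      tsum d (fun w => lbr [:: val l, val j & w]) (sig j (sig l P))
    - d`!%:R *: (d.+2%:R *: P).
    rewrite -(dynkin_lie P1) /dynkin_sum wsumS scaler_sumr -sumrB.
    by apply: eq_bigr => l _; rewrite wsumS scaler_sumr -sumrB.
  have KP : (d.+2 * d`!)%:R^-1 *: (d`!%:R *: (d.+2%:R *: P)) = P.
    by rewrite !scalerA -natrM [(d`! * _)%N]mulnC mulVf// scale1r.
  rewrite !scaleNr opprK scalerBr KP opprB; congr (_ + _); rewrite -scalerN.
  congr (_ *: _); rewrite -sumrN; apply: eq_bigr => l _.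
  by rewrite -sumrN; apply: eq_bigr => j _; rewrite sigP tsumN.
apply: lieZ; apply: lie_sum => l; apply: lie_sum => j; apply: tsum_wsum.
(* The first two letters already give an element of L'. Exchanging two adjacent later letters then
   changes the bracket by one with both entries in L'. *)
have u1 : lie 1 1 (brk (ncvar l) (ncvar j)).
  by apply: (@lie_brk _ _ 0 0); exact: lie_var.
move=> s1 i k s2 sd l1 l2 iN kN; rewrite !lbr_cons2.
rewrite !lbr_from_cat !lbr_from_cons -lbr_fromB.
have := lie_lbr_from u1 l1; move: (lbr_from _ s1) => x x1.
have -> : brk (brk x (ncvar i)) (ncvar k) - brk (brk x (ncvar k)) (ncvar i) =
    brk x (brk (ncvar i) (ncvar k)).
  by rewrite jacobi [brk (ncvar i) (brk _ _)]brkC.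
apply: (@lie_deg _ _ _ ((1 + size s1 + 1).+1 + size s2)); first by lia.
apply: lie_lbr_from => //; apply: lie_brkS => //.
by apply: (@lie_brk _ _ 0 0); exact: lie_var.
Qed.

(** A finite list of integrands with series as coefficients; [theta] iterates such a list. *)
Definition mom1_rep (T : A -> A) := exists Q : seq ((seq nat * nat) * A),
  forall u, T u = \sum_(q <- Q) mom [:: q.1] u *: q.2.

Lemma mom1_rep_sum n (T : 'I_n -> A -> A) :
  (forall i, mom1_rep (T i)) -> mom1_rep (fun u => \sum_(i < n) T i u).
Proof.
move=> /choice[Q TQ]; exists (flatten (codom Q)) => u.
rewrite big_flatten /= big_map big_enum /=.
by apply: eq_bigr => i _; rewrite TQ.
Qed.

Lemma mom1_repZ c T : mom1_rep T -> mom1_rep (fun u => c *: T u).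
Proof.
move=> [Q TQ]; exists [seq (q.1, c *: q.2) | q <- Q] => u.
rewrite TQ big_map scaler_sumr; apply: eq_bigr => q _ /=.
by rewrite !scalerA mulrC.
Qed.

(** Each further [tau] appends a letter to the integrand, so unfolding the sum leaves one moment of
    order 1 per word. *)
Lemma mom1_rep_tsum d b s j :
  mom1_rep (fun u => tsum d b (foldl (fun x i => tau i x) (sig j u) s)).
Proof.
elim: d b s => [|d IH] b s.
  by exists [:: ((s, j), b [::])] => u; rewrite big_seq1.
apply: mom1_rep_sum => i;
  case: (IH (fun w => b (val i :: w)) (rcons s i)) => Q TQ.
by exists Q => u; rewrite -TQ foldl_rcons.
Qed.

Definition ncdeg (d : nat) f := forall w, size w != d -> f w = 0.

Lemma ncdeg_sig d j f : ncdeg d.+1 f -> ncdeg d (sig j f).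
Proof. by move=> fd w wd; rewrite sigE fd. Qed.

Lemma ncdeg_tau d j f : ncdeg d.+1 f -> ncdeg d (tau j f).
Proof.
move=> fd w wd; transitivity (tau j (0 : A) w); last by rewrite linear0.
rewrite !tauE; by apply: sh_ext => v /perm_size /= vw; rewrite fd// vw.
Qed.

Lemma tsum_deg d e b f : ncdeg e f -> d != e -> tsum d b f = 0.
Proof.
elim: d e b f => [|d IH] e b f fe de /=; first by rewrite fe ?scale0r.
rewrite big1// => i _; case: e fe de => [|e] fe de; last first.
  by apply: (IH e) => //; exact: ncdeg_tau.
suff -> : tau i f = 0 by rewrite tsum0.
apply/funext => w; transitivity (tau i (0 : A) w); last by rewrite linear0.
rewrite !tauE; apply: sh_ext => v /perm_size /= vw.
by rewrite fe// vw.
Qed.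

(** One list serves all degrees in range, as needed for brackets whose entries differ in degree: by
    [tsum_deg] only the operator of the right degree survives on a homogeneous element. *)
Lemma mom1_rep_dynkin D : exists Q : seq ((seq nat * nat) * A),
  forall d P, (d <= D)%N -> lie 1 d P ->
    lie 2 d (P - \sum_(q <- Q) mom [:: q.1] P *: q.2).
Proof.
pose T (d : 'I_D) u := (- (d.+2 * d`!)%:R^-1) *: \sum_(l < N) \sum_(j < N)
  tsum d (fun w => lbr [:: val l, val j & w]) (tau l (sig j u)).
have [Q TQ] : mom1_rep (fun u => \sum_(d < D) T d u).
  apply: mom1_rep_sum => d; apply: mom1_repZ; apply: mom1_rep_sum => l.
  by apply: mom1_rep_sum => j; exact: (mom1_rep_tsum _ _ [:: val l]).
exists Q => -[|d] P dD Pd; rewrite -TQ.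
  rewrite (lie1_deg0 Pd) big1 ?subrr; first exact: lie_zero.
  move=> d _; rewrite /T big1 ?scaler0// => l _; rewrite big1// => j _.
  by rewrite !linear0 tsum0.
rewrite (bigD1 (Ordinal dD))//= big1 ?addr0; first exact: metabelian_dynkin.
move=> e ed; rewrite /T big1 ?scaler0// => l _; rewrite big1// => j _.
apply: (@tsum_deg _ d) => //; apply: ncdeg_tau; apply: ncdeg_sig => w wd.
by rewrite (lie_homog Pd)// negb_and wd.
Qed.

(** * Iterating the formula of order 1 along the lower central series of L' *)

Section Theta.
Variable Q : seq ((seq nat * nat) * A).

(** The sum over [q_1, ..., q_m] in [Q] of the moment of [f] with integrands [q_1.1, ..., q_m.1],
    times the product [q_1.2 * ... * q_m.2]. The order of the factors makes it split over products
    as moments do. *)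
Fixpoint theta m f : A :=
  if m is m'.+1 then \sum_(q <- Q) q.2 * theta m' (momop q.1 f)
  else f [::] *: 1.

Lemma theta1E f : theta 1 f = \sum_(q <- Q) mom [:: q.1] f *: q.2.
Proof. by apply: eq_bigr => q _ /=; rewrite -scalerAr mulr1. Qed.

Lemma thetaP m c f g : theta m (c *: f + g) = c *: theta m f + theta m g.
Proof.
elim: m f g => [|m IH] f g /=.
  by rewrite ncaddE ncscaleE scalerDl scalerA.
rewrite scaler_sumr -big_split; apply: eq_bigr => q _ /=.
by rewrite linearP /= IH mulrDr scalerAr.
Qed.
Lemma theta0 m : theta m 0 = 0.
Proof.
by have := thetaP m (-1) 0 0; rewrite scaler0 addr0 scaleN1r addNr.
Qed.
Lemma thetaB m f g : theta m (f - g) = theta m f - theta m g.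
Proof. by rewrite addrC -scaleN1r thetaP scaleN1r addrC. Qed.

Lemma theta_mom m f : (forall qs, size qs = m -> mom qs f = 0) -> theta m f = 0.
Proof.
elim: m f => [|m IH] f fm /=; first by rewrite [f _](fm [::])// scale0r.
rewrite big1// => q _; rewrite IH ?mulr0// => qs qsm.
by apply: (fm (q.1 :: qs)); rewrite /= qsm.
Qed.

Lemma theta_mul m f g : nc_closed g ->
  theta m (f * g) = \sum_(k < m.+1) theta k f * theta (m - k) g.
Proof.
move=> g0; elim: m f => [|m IH] f.
  by rewrite big_ord_recl big_ord0 addr0 /= ncmul0E -scalerAl mul1r scalerA.
rewrite big_ord_recl /= -scalerAl mul1r.
under eq_bigr => q _ do
  rewrite momop_mul// thetaP mulrDr -scalerAr IH mulr_sumr.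
rewrite big_split /= -scaler_sumr; congr (_ + _).
rewrite exchange_big; apply: eq_bigr => k _ /=.
by rewrite mulr_suml; apply: eq_bigr => q _; rewrite mulrA.
Qed.

(** In a product the [m] operators are shared out: a factor from L' needs at least one of them,
    having no constant term, and the other factor at least its own depth. *)
Lemma theta_vanish k d P : lie k d P -> forall m, (m < k)%N -> theta m P = 0.
Proof.
have th0 j e u : lie j e u -> theta 0 u = 0.
  by move=> /lie_nil u0; rewrite /= u0 scale0r.
elim=> {k d P} //.
- by move=> d e u v ud _ ve _ [|//] _; exact: th0 (lie_brk ud ve).
- move=> k d e u v u1 IHu vk IHv m mk.
  have [u0 v0] := (lie_closed u1, lie_closed vk).
  rewrite thetaB !theta_mul// !big1 ?subrr// => i _.
    have [ik|ik] := ltnP i k.+1; first by rewrite IHv// mul0r.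
    have -> : (m - i = 0)%N by have := ltn_ord i; lia.
    by rewrite (th0 _ _ _ u1) mulr0.
  have [i0|i0] := posnP i; first by rewrite i0 (th0 _ _ _ u1) mul0r.
  by rewrite IHv ?mulr0//; have := ltn_ord i; lia.
- move=> k d c u v _ IHu _ IHv m mk.
  by rewrite thetaP IHu// IHv// scaler0 addr0.
- by move=> k d m _; rewrite theta0.
- by move=> k d u _ IH m mk; apply: IH; exact: ltnW.
Qed.

Lemma theta_lie0 k d P : lie k d P -> theta 0 P = 0.
Proof. by move=> /lie_nil P0; rewrite /theta P0 scale0r. Qed.

Arguments theta : simpl never.

Variable D : nat.
Hypothesis Qmod : forall d P,
  (d <= D)%N -> lie 1 d P -> lie 2 d (P - theta 1 P).

(** On a bracket [brk u v] with [u] in L', only the split giving one operator to [u] and the rest to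
    [v] survives, so [theta] becomes the bracket of [theta 1 u] and [theta k.+1 v]. Replacing the
    entries one after the other costs only terms one step deeper. *)
Lemma theta_mod m d P : (d <= D)%N -> lie m.+1 d P ->
  lie m.+2 d (P - theta m.+1 P).
Proof.
suff gen k f : lie k d f -> forall m, (d <= D)%N -> k = m.+1 ->
    lie m.+2 d (f - theta m.+1 f) by move=> dD /gen; apply.
elim=> {k d f} //.
- by move=> d e u v ud _ ve _ n dD [<-]; apply: Qmod => //; exact: lie_brk.
- move=> k d e u v u1 _ vk IHv n dD [<-] {n}.
  have [u0 v0] := (lie_closed u1, lie_closed vk).
  have [dD' eD] : (d <= D /\ e <= D)%N by lia.
  have uQ := Qmod dD' u1; have vQ := IHv k eD erefl.
  have theta_uv : theta k.+2 (u * v) = theta 1 u * theta k.+1 v.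
    rewrite theta_mul// big_ord_recl big_ord_recl /= big1 ?addr0.
      by rewrite (theta_lie0 u1) mul0r add0r.
    by move=> i _; rewrite (theta_vanish vk) ?mulr0//= /bump /=; lia.
  have theta_vu : theta k.+2 (v * u) = theta k.+1 v * theta 1 u.
    rewrite theta_mul// big_ord_recr big_ord_recr /= big1 ?add0r.
      have -> : (k.+2 - k.+1 = 1)%N by lia.
      by rewrite subnn (theta_lie0 u1) mulr0 addr0.
    by move=> i _; rewrite (theta_vanish vk) ?mul0r.
  have -> : theta k.+2 (brk u v) = brk (theta 1 u) (theta k.+1 v).
    by rewrite /brk thetaB theta_uv theta_vu.
  have -> : brk u v - brk (theta 1 u) (theta k.+1 v) =
      brk (u - theta 1 u) v + brk (theta 1 u) (v - theta k.+1 v).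
    by rewrite brkBl brkBr addrA subrK.
  (* The first error has an entry in [L', L'] and gains a step by [lie_brkD]. For the second,
     [theta 1 u] lies in L' because it differs from [u] by an element of [L', L']. *)
  apply: lieD; first by have := lie_brkD uQ vk; rewrite add2n.
  apply: lie_brkS => //.
  by rewrite -[theta 1 u](subKr u); apply: lieB => //; exact: lie_sub.
- move=> k d c u v _ IHu _ IHv n dD kn; rewrite thetaP opprD addrACA -scalerBr.
  by apply: lie_lin; [exact: IHu | exact: IHv].
- by move=> k d n dD _; rewrite theta0 subr0; exact: lie_zero.
- move=> k d u uk _ n dD kn.
  by rewrite (theta_vanish uk) ?kn// subr0 -kn.
Qed.

End Theta.

(** Induction on [n]: once [P] lies in the term of index [n.+1], it is congruent to [theta n.+1 P]
    modulo the next term, and the moments of order [n.+1] make this zero. *)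
Lemma lie_moments n d P : lie 1 d P ->
  (forall qs, (0 < size qs <= n)%N -> mom qs P = 0) -> lie n.+1 d P.
Proof.
move=> P1; have [Q Qmod] := mom1_rep_dynkin d.
elim: n => [//|n IH] Pn; rewrite -[P]subr0.
rewrite -[X in P - X](@theta_mom Q n.+1 P).
  apply: (theta_mod (D := d)) => //.
    by move=> e u ed u1; rewrite theta1E; exact: Qmod.
  by apply: IH => qs /andP[q0 qn]; apply: Pn; rewrite q0 ltnW.
by move=> qs qn; apply: Pn; rewrite qn leqnn.
Qed.

End DynkinMoments.

(** * Series killed by proper shuffles are Lie series *)

Section ShuffleLie.
Variables (R : realType) (N : nat).
Local Notation A := (ncseries R).
Local Notation ncvar := (@ncvar R).
Local Notation lie := (@lie R N).
Local Notation wsum := (@wsum R N).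
Local Notation letters := (letters N).
Implicit Types (f g P : A) (v w : seq nat) (c : R[i]).

Fixpoint rbr w : A :=
  if w is i :: w' then
    if w' is [::] then ncvar i else brk (ncvar i) (rbr w')
  else 0.

Lemma lie_rbr d w : size w = d.+1 -> letters w ->
  lie 0 d (rbr w) /\ ((0 < d)%N -> lie 1 d (rbr w)).
Proof.
elim: d w => [|d IH] [//|i w]; rewrite /= => -[wd] /andP[iN wN].
  by rewrite (size0nil wd); split=> //; exact: lie_var.
suff w1 : lie 1 d.+1 (rbr (i :: w)) by split=> // ; exact: lie_sub.
case: w wd wN => // j w wd wN; have [w0 _] := IH _ wd wN.
by rewrite -[d.+1]/(0 + d).+1; apply: lie_brk => //; exact: lie_var.
Qed.

Lemma lie_wsum k e d b f :
  (forall w, size w = d -> letters w -> lie k e (b w)) -> lie k e (wsum d b f).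
Proof.
elim: d b f => [|d IH] b f bb' /=; first by apply: lieZ; exact: bb'.
apply: lie_sum => i; apply: IH => w wd wN; apply: bb' => /=;
  first by rewrite wd.
by rewrite ltn_ord.
Qed.

Lemma ncvar_mul_cons i f a w : (ncvar i * f) (a :: w) = (a == i)%:R * f w.
Proof.
rewrite -sigE sig_mul sig_ncvar -scalerAl mul1r ncaddE !ncscaleE.
by rewrite /ncvar /= mul0r add0r.
Qed.

Lemma mul_ncvar_rcons i f w b : (f * ncvar i) (rcons w b) = (b == i)%:R * f w.
Proof.
elim: w f => [|c w IH] f.
  rewrite -sigE sig_mul sig_ncvar ncaddE !ncscaleE ncmul0E nconeE eqxx.
  by rewrite /ncvar /= !mulr0 addr0 mulr1 mulrC.
rewrite rcons_cons -sigE sig_mul sig_ncvar ncaddE !ncscaleE nconeE IH.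
by rewrite sigE /= -size_eq0 size_rcons /= !mulr0 add0r.
Qed.

(** A weighted convolution of the identity with word reversal. Reversal with the sign [(-1)^length]
    is the antipode of the shuffle algebra. *)
Definition cut_sum (q : nat -> R[i]) (v : seq nat) f :=
  \sum_(k < (size v).+1) q k * sh (take k v) (rev (drop k v)) f.

(** A shuffle of a prefix of the word with the reversed remaining suffix starts either with the
    first letter of the word or with its last one. *)
Lemma cut_sum_cons q a v v' b f : a :: v = rcons v' b ->
  cut_sum q (a :: v) f =
  cut_sum (fun k => q k.+1) v (sig a f) + cut_sum q v' (sig b f).
Proof.
move=> vE; set n := size v.
have v'n : size v' = n by have := congr1 size vE; rewrite size_rcons => -[].
(* At [k = 0] the prefix is empty and cannot supply the first letter; at [k = n.+1] the suffix is
   empty and cannot supply the last. *)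
pose Aterm k := if (0 < k)%N then
  q k * sh (take k.-1 v) (rev (drop k (a :: v))) (sig a f) else 0.
pose Bterm k := if (k <= n)%N then
  q k * sh (take k v') (rev (drop k v')) (sig b f) else 0.
transitivity (\sum_(k < n.+2) (Aterm k + Bterm k)).
  apply: eq_bigr => -[k kn] _ /=; rewrite /Aterm /Bterm.
  have [kn'|kn'] := leqP k n.
    have -> : drop k (a :: v) = rcons (drop k v') b.
      by rewrite vE drop_rcons// v'n.
    have -> : take k (a :: v) = take k v'.
      by rewrite vE -cats1 takel_cat// v'n.
    rewrite rev_rcons; case: k kn kn' => [|k] kn kn'.
      by rewrite /= !take0 !sh0s sigE add0r.
    have -> : take k.+1 v' = a :: take k v.
      by have := congr1 (take k.+1) vE; rewrite -cats1 takel_cat ?v'n.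
    by rewrite sh_cons mulrDr.
  have -> : k = n.+1 by apply/eqP; rewrite eqn_leq kn' andbT -ltnS.
  by rewrite ltn0Sn addr0 /= drop_size take_size /= !shs0 sigE.
have A0 : Aterm 0%N = 0 by [].
have Bn : Bterm n.+1 = 0 by rewrite /Bterm ltnn.
rewrite big_split /= [X in X + _]big_ord_recl [X in _ + X]big_ord_recr /=.
rewrite A0 Bn add0r addr0 /cut_sum v'n; congr (_ + _).
by apply: eq_bigr => -[k kn] _ /=; rewrite /Bterm -ltnS kn.
Qed.

(** The antipode identity. In [cut_sum_cons] the sign flips only when the last letter is removed;
    both parts vanish by induction, or cancel each other for a single letter. *)
Lemma cut_sum_antipode v f : (0 < size v)%N ->
  cut_sum (fun k => (-1) ^+ (size v - k)) v f = 0.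
Proof.
move: {2 3}(size v) (erefl (size v)) => n; elim: n v f => [//|n IH] v f vn _.
case: v vn => // a v [vn].
have [v' [b vE]] : exists v' b, a :: v = rcons v' b.
  by exists (belast a v), (last a v); rewrite -lastI.
have v'n : size v' = n.
  by have := congr1 size vE; rewrite size_rcons /= vn => -[].
rewrite (cut_sum_cons _ _ vE).
have -> : cut_sum (fun k => (-1) ^+ (size (a :: v) - k)) v' (sig b f) =
    - cut_sum (fun k => (-1) ^+ (size v' - k)) v' (sig b f).
  rewrite /cut_sum -sumrN; apply: eq_bigr => -[k kn] _ /=.
  by rewrite vn -v'n subSn -1?ltnS// exprS !mulN1r mulNr.
have [n0|n0] := posnP n; last by rewrite !(IH _ _ _)// ?v'n// subr0.
move: vn v'n vE; rewrite n0 => /size0nil -> /size0nil -> [->].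
by rewrite subrr.
Qed.

(** The coefficient at [v] of a bracket with [ncvar i] on the left involves [v] without its first or
    without its last letter, the same recursion as in [cut_sum_cons]. *)
Lemma rbr_sum_eval d f v : size v = d.+1 -> letters v ->
  wsum d.+1 rbr f v = cut_sum (fun k => (-1) ^+ (d.+1 - k) * k%:R) v f.
Proof.
elim: d f v => [|d IH] f v vd vN.
  case: v vd vN => [//|a [|//]] _ /andP[aN _].
  rewrite /cut_sum !big_ord_recl big_ord0 /= !mulr0 mul0r !mul1r addr0 add0r.
  rewrite ncsumE (bigD1 (Ordinal aN))//= big1 ?addr0.
    by rewrite ncscaleE sigE /ncvar eqxx mulr1 /bump /= ?subnn ?expr0 ?mul1r ?shs0.
  move=> i; rewrite -val_eqE /= => /negPf ia.
  by rewrite ncscaleE /ncvar eqseq_cons eq_sym ia mulr0.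
have -> : wsum d.+2 rbr f =
    \sum_(i < N) brk (ncvar i) (wsum d.+1 rbr (sig i f)).
  rewrite wsumS; apply: eq_bigr => i _.
  rewrite -[RHS](@wsum_lin _ N (brk (ncvar i))); last first.
    by move=> c x y; rewrite brkPr.
  by apply: eq_wsum => -[].
case: v vd vN => // a v [vd] avN; have /andP[aN vN] := avN.
have [v' [b vE]] : exists v' b, a :: v = rcons v' b.
  by exists (belast a v), (last a v); rewrite -lastI.
have v'd : size v' = d.+1.
  by have := congr1 size vE; rewrite size_rcons /= vd => -[].
have /andP[bN v'N] : (b < N)%N && letters v'.
  by move: avN; rewrite vE /letters all_rcons.
rewrite ncsumE (eq_bigr (fun i : 'I_N =>
  (a == i)%:R * wsum d.+1 rbr (sig i f) v -
  (b == i)%:R * wsum d.+1 rbr (sig i f) v')); last first.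
  move=> i _; rewrite /brk ncaddE ncoppE ncvar_mul_cons.
  by rewrite [in X in _ - X = _]vE mul_ncvar_rcons.
have pick a' (aN' : (a' < N)%N) (F : nat -> R[i]) :
    \sum_(i < N) (a' == i)%:R * F i = F a'.
  rewrite (bigD1 (Ordinal aN'))//= eqxx mul1r big1 ?addr0// => i.
  by rewrite -val_eqE eq_sym /= => /negPf ->; rewrite mul0r.
rewrite sumrB (pick a aN (fun i => wsum d.+1 rbr (sig i f) v)).
rewrite (pick b bN (fun i => wsum d.+1 rbr (sig i f) v')) !IH//.
rewrite (cut_sum_cons _ _ vE); congr (_ + _).
  (* Removing the first letter shifts the weight from [k] to [k.+1]; the difference is the antipode
     sum, which is zero. *)
  transitivity (cut_sum (fun k => (-1) ^+ (d.+1 - k) * k%:R) v (sig a f) +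
                cut_sum (fun k => (-1) ^+ (size v - k)) v (sig a f)).
    by rewrite cut_sum_antipode ?addr0// vd.
  rewrite /cut_sum -big_split; apply: eq_bigr => -[k kn] _ /=.
  by rewrite vd subSS -mulrDl -natr1 mulrDr mulr1.
rewrite /cut_sum -sumrN; apply: eq_bigr => -[k kn] _ /=.
have kd : (k <= d.+1)%N by rewrite -v'd -ltnS.
by rewrite [in RHS]subSn// exprS mulN1r !mulNr.
Qed.

(** With proper shuffles gone, [rbr_sum_eval] leaves [d.+1] times the coefficient itself, so [P] is
    a combination of right-normed brackets. *)
Lemma shuffle_lie d P : nchomog N d.+1 P ->
  (forall s t, (0 < size s)%N -> (0 < size t)%N -> sh s t P = 0) ->
  lie 0 d P /\ ((0 < d)%N -> lie 1 d P).
Proof.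
move=> Pd Psh.
have PE : P = d.+1%:R^-1 *: wsum d.+1 rbr P.
  apply/funext => v; rewrite ncscaleE.
  have [/andP[/eqP vd vN]|vN] := boolP ((size v == d.+1) && letters v).
    rewrite rbr_sum_eval// /cut_sum big_ord_recr /= big1 ?add0r.
      by rewrite take_size drop_size shs0 vd subnn mul1r mulrA mulVf ?mul1r//.
    (* The cut with empty prefix is no proper shuffle, but its weight [k] is zero. *)
    move=> -[[|k] kd] _ /=; first by rewrite !mulr0 mul0r.
    rewrite [sh _ _ _]Psh ?mulr0// ?size_rev ?size_drop ?subn_gt0//.
    by rewrite size_take kd.
  rewrite Pd// (@lie_homog _ N 0 d) ?mulr0//.
  by apply: lie_wsum => w wd wN; have [] := lie_rbr wd wN.
by rewrite PE; split=> [|d0]; apply: lieZ; apply: lie_wsum => w wd wN;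
  have [w0 w1] := lie_rbr wd wN => //; exact: w1.
Qed.

End ShuffleLie.

(** * Lie polynomials as leading terms of group elements *)

Section SubgroupSeries.
Variable G : groupType.
Implicit Types (H K : set G) (x y : G).

Lemma smallest_subgroup H : is_subgroup (smallest (@is_subgroup G) H).
Proof.
split=> [K [[]]//|x y xH yH K KH|x xH K KH].
  by have [[_ + _] _] := KH; apply; [exact: xH | exact: yH].
by have [[_ _ +] _] := KH; apply; exact: xH.
Qed.

Lemma lower_central_subgroup H n : is_subgroup H ->
  is_subgroup (lower_central H n).
Proof. by case: n => [//|n] _; exact: smallest_subgroup. Qed.

Lemma subgroup_comm H x y : is_subgroup H -> H x -> H y -> H [~ x, y]%g.
Proof.
move=> [_ HM HV] Hx Hy; rewrite /commg /conjg; apply: (HM _ _); first exact: HV.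
by apply: (HM _ _); [exact: HV | exact: HM].
Qed.

Lemma lower_centralS H n : is_subgroup H ->
  lower_central H n.+1 `<=` lower_central H n.
Proof.
move=> Hgrp; elim: n => [|n IH] x; apply.
  by split=> // z [a [b [aH bH ->]]]; exact: subgroup_comm.
split; first exact: smallest_subgroup.
move=> z [a [b [aH bH ->]]] K [_]; apply.
by exists a, b; split=> //; exact: IH.
Qed.

Lemma lower_central_sub H K n : H `<=` K ->
  lower_central H n `<=` lower_central K n.
Proof.
move=> HK; elim: n => [//|n IH] x; apply; split; first exact: smallest_subgroup.
move=> z [a [b [aH bH ->]]] L [_]; apply.
by exists a, b; split=> //; [exact: HK | exact: IH].
Qed.

End SubgroupSeries.

(** * Products of exponentials with a prescribed leading term *)

Section Realization.
Variable R : realType.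
Local Notation A := (ncseries R).
Local Notation G := (ncgroup R).
Local Notation ncvar := (@ncvar R).
Implicit Types (f g P : A) (x y : G) (c : R[i]).

Definition ncord m f := forall w, (size w < m)%N -> f w = 0.

Lemma ncordM m n f g : ncord m f -> ncord n g -> ncord (m + n) (f * g).
Proof.
move=> fm gn w wmn; rewrite ncmulE big1// => k _.
have [km|km] := ltnP (size (take k w)) m; first by rewrite fm// mul0r.
rewrite gn ?mulr0// size_drop; have := ltn_ord k; rewrite ltnS => kw.
by move: km; rewrite size_takel//; lia.
Qed.
Lemma ncordD m f g : ncord m f -> ncord m g -> ncord m (f + g).
Proof. by move=> fm gm w wm; rewrite ncaddE fm// gm// addr0. Qed.
Lemma ncordN m f : ncord m f -> ncord m (- f).
Proof. by move=> fm w wm; rewrite ncoppE fm// oppr0. Qed.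
Lemma ncordB m f g : ncord m f -> ncord m g -> ncord m (f - g).
Proof. by move=> fm gm; apply: ncordD => //; exact: ncordN. Qed.
Lemma ncord_le m n f : (m <= n)%N -> ncord n f -> ncord m f.
Proof. by move=> mn fn w wm; apply: fn; exact: leq_trans wm mn. Qed.

Lemma ncord_val x : ncord 1 (\val x - 1).
Proof. by case=> // _; rewrite ncaddE ncval_nil subrr. Qed.

(** The exponential of [c *: ncvar i], the endpoint of a straight segment. *)
Definition ncexp c (i : nat) : A :=
  fun w => if all (pred1 i) w then c ^+ size w / (size w)`!%:R else 0.

Lemma ncexpD a b i : ncexp a i * ncexp b i = ncexp (a + b) i.
Proof.
apply/funext => w; rewrite ncmulE /ncexp; case: ifPn => [wi|wi]; last first.
  rewrite big1// => k _; move: wi; rewrite -{1}(cat_take_drop k w) all_cat.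
  by case: all; case: all; rewrite // ?mul0r ?mulr0.
set n := size w.
rewrite addrC exprDn mulr_suml; apply: eq_bigr => -[k kn] _ /=.
move: wi; rewrite -{1}(cat_take_drop k w) all_cat => /andP[-> ->].
rewrite ltnS in kn; rewrite size_takel// size_drop -/n -(bin_fact kn) !natrM.
rewrite -mulr_natr.
have nz m : m`!%:R != 0 :> R[i] by rewrite pnatr_eq0 -lt0n fact_gt0.
have bz : 'C(n, k)%:R != 0 :> R[i] by rewrite pnatr_eq0 -lt0n bin_gt0.
by have k0 := nz k; have nk0 := nz (n - k)%N; field; rewrite k0 nk0 bz.
Qed.

Lemma ncexp0 i : ncexp 0 i = 1.
Proof.
apply/funext => -[|j w]; rewrite /ncexp nconeE /=.
  by rewrite expr0 divr1.
by rewrite expr0n /= mul0r if_same.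
Qed.

Fact ncexp_subproof c i : ncexp c i [::] = 1.
Proof. by rewrite /ncexp /= expr0 divr1. Qed.
Definition gexp c i : G := exist _ (ncexp c i) (mem_set (ncexp_subproof c i)).

Lemma gexpV c i : (gexp c i)^-1%g = gexp (- c) i.
Proof.
apply: (mulgI (gexp c i)); rewrite mulgV; apply: val_inj => /=.
by rewrite ncexpD subrr ncexp0.
Qed.

Definition exp_prod (l : seq (R[i] * nat)) : G :=
  foldr (fun p x => gexp p.1 p.2 * x)%g 1%g l.
Definition exp_group : set G := range exp_prod.

Lemma exp_prod_cat l1 l2 : exp_prod (l1 ++ l2) = (exp_prod l1 * exp_prod l2)%g.
Proof. by elim: l1 => [|p l IH] /=; rewrite ?mul1g// IH mulgA. Qed.

Lemma exp_group_subgroup : is_subgroup exp_group.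
Proof.
split; first by exists [::].
  by move=> _ _ [l1 _ <-] [l2 _ <-]; exists (l1 ++ l2) => //;
    rewrite exp_prod_cat.
move=> _ [l _ <-]; elim: l => [|[c i] l [l' _ l'E]] /=.
  by exists [::]; rewrite // invg1.
by exists (l' ++ [:: (- c, i)]) => //;
  rewrite exp_prod_cat l'E invgM gexpV /= mulg1.
Qed.

Definition closed_exp_group : set G :=
  exp_group `&` [set x | forall i, (\val x : A) [:: i] = 0].

Lemma ncval1M x y i :
  (\val (x * y)%g : A) [:: i] = (\val x : A) [:: i] + (\val y : A) [:: i].
Proof.
rewrite ncvalM -sigE sig_mul ncaddE ncscaleE ncmul0E !sigE !ncval_nil.
by rewrite mul1r mulr1 addrC.
Qed.

Lemma closed_exp_group_subgroup : is_subgroup closed_exp_group.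
Proof.
have [G1 GM GV] := exp_group_subgroup.
split; first by split=> // i; rewrite ncval1.
  move=> x y [xG x0] [yG y0]; split; first exact: GM.
  by move=> i; rewrite ncval1M x0 y0 addr0.
move=> x [xG x0]; split=> [|i]; first exact: GV.
have : (\val (x * x^-1)%g : A) [:: i] = 0 by rewrite mulgV ncval1.
by rewrite ncval1M x0 add0r.
Qed.

(** For [P] of degree [d.+1], indexed as in [lie], this says that [x] is [1 + P] up to longer
    words. *)
Definition leads d P x := ncord d.+2 (\val x - 1 - P).

Lemma leadsM d P Q x y : ncord d.+1 P -> ncord d.+1 Q ->
  leads d P x -> leads d Q y -> leads d (P + Q) (x * y)%g.
Proof.
move=> Pd Qd xP yQ; rewrite /leads ncvalM.
have -> : \val x * \val y - 1 - (P + Q) = (\val x - 1 - P) + (\val y - 1 - Q) +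
    (\val x - 1) * (\val y - 1) :> A.
  rewrite mulrBl mulrBr mul1r mulr1; apply/funext => w.
  by rewrite !(ncaddE, ncoppE); ring.
apply: ncordD; first exact: ncordD.
have le (f : G) (Q' : A) : leads d Q' f -> ncord d.+1 Q' ->
  ncord d.+1 (\val f - 1).
  move=> fQ Qd'; rewrite -[_ - 1](subrK Q'); apply: ncordD => //.
  exact: ncord_le fQ.
apply: (@ncord_le _ (d.+1 + d.+1)); first by lia.
by apply: ncordM; [exact: le Pd | exact: le Qd].
Qed.

(** In [ncval_comm] the invertible factor is 1 up to longer words, and each entry of the commutator
    may be replaced by its leading term. *)
Lemma leads_comm d e P Q x y : ncord d.+1 P -> ncord e.+1 Q ->
  leads d P x -> leads e Q y -> leads (d + e).+1 (brk P Q) [~ x, y]%g.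
Proof.
move=> Pd Qd xP yQ; rewrite /leads ncval_comm.
have le d' (f : G) (Q' : A) : leads d' Q' f -> ncord d'.+1 Q' ->
  ncord d'.+1 (\val f - 1).
  move=> fQ Qd'; rewrite -[_ - 1](subrK Q'); apply: ncordD => //.
  exact: ncord_le fQ.
have xd := le _ _ _ xP Pd; have yd := le _ _ _ yQ Qd.
move: (ncord_val (x^-1 * y^-1)%g) xP yQ xd yd; rewrite -ncvalM /leads.
move: (\val (x^-1 * y^-1)%g : A) (\val x - 1 : A) (\val y - 1 : A).
move=> z u v z1 uP vQ ud vd.
have -> : z * (u * v - v * u) - brk P Q = (z - 1) * (u * v - v * u) +
    ((u - P) * v + P * (v - Q) - ((v - Q) * u + Q * (u - P))).
  rewrite /brk !mulrBl !mulrBr !mul1r; apply/funext => w.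
  by rewrite !(ncaddE, ncoppE); ring.
have ordM i j (f g : A) : ncord i f -> ncord j g -> (i + j)%N = (d + e).+3 ->
  ncord (d + e).+3 (f * g) by move=> fi gj <-; exact: ncordM.
apply: ncordD.
  rewrite mulrBr; apply: ncordB; apply: (ordM 1%N (d.+1 + e.+1)%N) => //.
  - exact: ncordM.
  - by lia.
  - by rewrite addnC; exact: ncordM.
  - by lia.
apply: ncordB; apply: ncordD.
- by apply: (ordM d.+2 e.+1) => //; lia.
- by apply: (ordM d.+1 e.+2) => //; lia.
- by apply: (ordM e.+2 d.+1) => //; lia.
- by apply: (ordM e.+1 d.+2) => //; lia.
Qed.

Lemma lie_ncord N k d P : lie N k d P -> ncord d.+1 P.
Proof.
by move=> /lie_homog Pd w wd; rewrite Pd// negb_and neq_ltn wd.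
Qed.

Lemma leads_gexp c i : leads 0 (c *: ncvar i) (gexp c i).
Proof.
move=> [|j [|//]] _; rewrite !(ncaddE, ncoppE) ncscaleE nconeE /ncvar /=.
  by rewrite ncexp_subproof mulr0 subrr subr0.
rewrite /ncexp /= andbT eqseq_cons andbT subr0 expr1 divr1.
by case: eqP => _; rewrite ?mulr1 ?mulr0 subrr.
Qed.

(** Brackets are realized by group commutators and sums by products. The scalar [c] is part of the
    claim because a group has no scaling: it is pushed into one entry of each bracket, down to an
    exponential. *)
Lemma lie_realization N k d P : lie N k d P -> forall c, exists2 x : G,
  (if k is j.+1 then lower_central closed_exp_group j x else exp_group x)
  & leads d (c *: P) x.
Proof.
have K0 := closed_exp_group_subgroup.
elim=> {k d P}.
- move=> i iN c; exists (gexp c i); last exact: leads_gexp.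
  by exists [:: (c, i)] => //=; rewrite mulg1.
- move=> d e u v ud IHu ve IHv c.
  have [x xG xc] := IHu c; have [y yG y1] := IHv 1.
  have xy : leads (d + e).+1 (c *: brk u v) [~ x, y]%g.
    rewrite -[v]scale1r -brkZl; apply: leads_comm => //.
      exact: lie_ncord (lieZ c ud).
    exact: lie_ncord (lieZ 1 ve).
  (* The entries need not be closed; their commutator is, since its leading term has degree at least
     2. *)
  exists [~ x, y]%g => //; split.
    exact: subgroup_comm exp_group_subgroup xG yG.
  move=> i; have := xy [:: i] isT; rewrite !(ncaddE, ncoppE) nconeE ncscaleE.
  by rewrite (lie_ncord (lie_brk ud ve))// mulr0 !subr0.
- move=> k d e u v ud IHu ve IHv c.
  have [x xG xc] := IHu c; have [y yG y1] := IHv 1.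
  exists [~ x, y]%g; first by move=> L [_]; apply; exists x, y.
  rewrite -[v]scale1r -brkZl; apply: leads_comm => //.
    exact: lie_ncord (lieZ c ud).
  exact: lie_ncord (lieZ 1 ve).
- move=> k d c u v ud IHu vd IHv a.
  have [x xG xc] := IHu (a * c); have [y yG y1] := IHv a.
  exists (x * y)%g.
    case: k {IHu IHv ud vd} xG yG => [|k].
      by have [_ + _] := exp_group_subgroup; apply.
    by have [_ + _] := lower_central_subgroup k K0; apply.
  rewrite scalerDr scalerA; apply: leadsM => //.
    exact: lie_ncord (lieZ _ ud).
  exact: lie_ncord (lieZ _ vd).
- move=> k d c; exists 1%g.
    case: k => [|k]; first by have [] := exp_group_subgroup.
    by have [] := lower_central_subgroup k K0.
  by move=> w _; rewrite ncval1 subrr scaler0 subr0.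
- move=> k d u _ IH c; have [x xG xc] := IH c; exists x => //.
  by case: k {IH} xG => [[]//|k]; exact: lower_centralS.
Qed.

End Realization.

(** * The fundamental theorem of calculus for Lipschitz functions *)

Section LipschitzFTC.
Variable R : realType.
Local Notation mu := (@lebesgue_measure R).

Lemma is_derive_seq (f : R -> R) (x l : R) : is_derive x 1 f l ->
  n.+1%:R * (f (x + n.+1%:R^-1) - f x) @[n --> \oo] --> l.
Proof.
case=> df <-.
have : h^-1 *: ((f \o shift x) (h *: (1 : R)) - f x) @[h --> 0^']
    --> 'D_1 f x.
  exact: df.
have h0 : (n.+1%:R^-1 : R) @[n --> \oo] --> (0 : R)^'.
  move=> A [e /= e0 eA].
  have := @cvg_harmonic R; move=> /cvgrPdist_lt/(_ e e0).
  apply: filterS => n /= ne; apply: eA; [exact: ne|].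
  by rewrite invr_eq0 pnatr_eq0.
move=> /(cvg_comp _ _ h0); apply: cvg_trans; apply: near_eq_cvg.
by apply: nearW => n; rewrite /= invrK scaler1 [x + _]addrC.
Qed.

Lemma lipschitz_continuous (f : R -> R) (K : R) :
  (forall x y, `|f x - f y| <= K * `|x - y|) -> continuous f.
Proof.
move=> fK x; apply/cvgrPdist_lt => e e0.
have K0 : 0 <= K.
  by have := le_trans (normr_ge0 _) (fK 1 0); rewrite subr0 normr1 mulr1.
have d0 : 0 < e / (K + 1) by rewrite divr_gt0// ltr_wpDl.
near=> y; apply: le_lt_trans (fK x y) _.
apply: (@le_lt_trans _ _ ((K + 1) * `|x - y|)).
  by rewrite ler_wpM2r// lerDl.
rewrite mulrC -ltr_pdivlMr; last exact: ltr_wpDl.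
by near: y; apply: cvgr_dist_lt.
Unshelve. all: by end_near. Qed.

(* The difference quotients of [f] are bounded by [K], so dominated convergence
   applies to them; their integrals are computed with a primitive of [f]. *)
Lemma lipschitz_FTC (f h : R -> R) (K T : R) :
  (forall x y, x \in `[0, T] -> y \in `[0, T] ->
    `|f x - f y| <= K * `|x - y|) ->
  measurable_fun `[0, T] h ->
  {ae mu, forall x : R, x \in `[0, T] -> is_derive x 1 f (h x)} ->
  forall x, x \in `[0, T] -> \int[mu]_(t in `[0, x]) h t = f x - f 0.
Proof.
move=> fK mh dfh x; rewrite in_itv/= => /andP[];
  rewrite le_eqVlt => /orP[/eqP <- _|x0 xT].
  by rewrite set_itv1 Rintegral_set1 subrr.
have T0 : 0 < T by exact: lt_le_trans xT.
(* Clamping the argument extends [f] to a Lipschitz function on the whole line, so that difference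
   quotients make sense everywhere. *)
pose cl (s : R) := Num.max 0 (Num.min s T).
have cl_in s : cl s \in `[0, T].
  by rewrite in_itv/= le_max lexx /= ge_max ge_min lexx orbT (ltW T0).
have max_lip (a b : R) : `|Num.max 0 a - Num.max 0 b| <= `|a - b|.
  by rewrite ler_norml; have := ler_norm (a - b); have := ler_norm (b - a);
    rewrite [`|b - a|]distrC; case: (leP 0 a) => ?; case: (leP 0 b) => ? ? ?;
      lra.
have min_lip (a b : R) : `|Num.min a T - Num.min b T| <= `|a - b|.
  by rewrite ler_norml; have := ler_norm (a - b); have := ler_norm (b - a);
    rewrite [`|b - a|]distrC; case: (leP a T) => ?; case: (leP b T) => ? ? ?;
      lra.
have cl_lip s t : `|cl s - cl t| <= `|s - t| by exact: le_trans (max_lip _ _) _.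
have clE s : s \in `[0, T] -> cl s = s.
  by rewrite in_itv/= => /andP[s0 sT]; rewrite /cl (min_idPl sT) (max_idPr s0).
have K0 : 0 <= K.
  have := fK 0 T; rewrite !in_itv/= !lexx (ltW T0) => /(_ isT isT).
  by move=> /(le_trans (normr_ge0 _));
    rewrite pmulr_lge0// normr_gt0 sub0r oppr_eq0 gt_eqF.
pose ft s := f (cl s).
have ftK s t : `|ft s - ft t| <= K * `|s - t|.
  by apply: le_trans (fK _ _ (cl_in s) (cl_in t)) _; rewrite ler_wpM2l.
have ftE s : s \in `[0, T] -> ft s = f s by move=> /clE sE; rewrite /ft sE.
have ftc : continuous ft by exact: lipschitz_continuous ftK.
(* The primitive starts at -1 to be differentiable at 0 as well. *)
pose Phi (y : R) : R := \int[mu]_(t in `[-1, y]) ft t.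
have dPhi (y : R) : -1 < y -> is_derive y 1 Phi (ft y).
  move=> y1.
  have yy1 : y < y + 1 by rewrite ltrDl.
  have ift : mu.-integrable `[-1, y + 1] (EFin \o ft).
    apply: continuous_compact_integrable; first exact: segment_compact.
    exact: continuous_subspaceT.
  have [d1 <-] := continuous_FTC1_closed yy1 ift y1 (ftc y).
  by rewrite derive1E; exact: derivableP.
pose g (n : nat) (s : R) : R := n.+1%:R * (ft (s + n.+1%:R^-1) - ft s).
pose G (n : nat) (s : R) : R := n.+1%:R * (Phi (s + n.+1%:R^-1) - Phi s).
have dG n (s : R) : -1 < s -> is_derive s 1 (G n) (g n s).
  move=> s1; apply: is_deriveZ; apply: is_deriveB; last exact: dPhi.
  have s2 : -1 < s + n.+1%:R^-1 by apply: lt_trans s1 _; rewrite ltrDl invr_gt0.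
  rewrite -[ft (_ + _)]mulr1.
  exact: (@is_derive1_comp _ Phi (shift n.+1%:R^-1) s _ _ (dPhi _ s2)
    (is_derive_shift _ _ _)).
have Gc n (s : R) : -1 < s -> {for s, continuous (G n)}.
  move=> s1; apply: differentiable_continuous; apply/derivable1_diffP.
  by have [] := dG n s s1.
have m10 (s : R) : 0 <= s -> -1 < s by move=> s0;
  rewrite (lt_le_trans _ s0)// ltrN10.
have gc n : continuous (g n).
  move=> s; apply: cvgM; first exact: cvg_cst.
  apply: cvgB; last exact: ftc.
  by apply: continuous_comp; [apply: cvgD;
    [exact: cvg_id|exact: cvg_cst] | exact: ftc].
have intg n : (\int[mu]_(s in `[0%R, x]) (g n s)%:E = (G n x - G n 0)%R%:E)%E.
  rewrite (@continuous_FTC2 _ (g n) (G n))//.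
  - exact: continuous_subspaceT.
  - split.
    + by move=> s; rewrite in_itv/= => /andP[s0 _];
      have [] := dG n s (m10 _ (ltW s0)).
    + by apply: cvg_at_right_filter; exact: Gc.
    + by apply: cvg_at_left_filter; apply: Gc; exact: m10 (ltW x0).
  - move=> s; rewrite in_itv/= => /andP[s0 _]; rewrite derive1E.
    by have [_ ->] := dG n s (m10 _ (ltW s0)).
have sub0x : `[0, x] `<=` `[0, T].
  by apply: subset_itvl; rewrite bnd_simp.
have [] := @dominated_convergence _ _ R mu `[0, x] (measurable_itv _)
  (fun n => EFin \o g n) (EFin \o h) (cst K%:E).
- move=> n; apply/measurable_EFinP; apply: measurable_funTS.
  exact: continuous_measurable_fun.
- by apply/measurable_EFinP; exact: measurable_funS mh.
(* The end point is set aside: for [s < T] the points [s + 1/(n+1)] eventually stay in the interval,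
   where [ft] is [f]. *)
- have aeT : {ae mu, forall s, s != T}.
    exists [set T]; split => //; first exact: lebesgue_measure_set1.
    by move=> s /= /negP; rewrite negbK => /eqP.
  near=> s => s0x; apply/fine_cvgP; split; first by apply: nearW.
  have sT : s \in `[0, T] by exact: sub0x s0x.
  have dfs : s \in `[0, T] -> is_derive s 1 f (h s) by near: s; exact: dfh.
  have ds := dfs sT.
  have sneT : s != T by near: s.
  apply: cvg_trans (is_derive_seq ds); apply: near_eq_cvg => /=.
  have sltT : 0 < T - s.
    by rewrite subr_gt0 lt_neqAle sneT; move: sT; rewrite in_itv/= => /andP[].
  have := @cvg_harmonic R; move=> /cvgrPdist_lt/(_ _ sltT).
  apply: filterS => n /= nT; rewrite /g.
  have sn : s + n.+1%:R^-1 \in `[0, T].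
    have n0 : 0 < n.+1%:R^-1 :> R by rewrite invr_gt0.
    move: nT sT; rewrite sub0r normrN gtr0_norm// !in_itv/= => nT /andP[s0 _].
    by move: n.+1%:R^-1 n0 nT => q n0 nT; apply/andP; split; lra.
  by rewrite (ftE _ sn) (ftE _ sT).
- apply: (@continuous_compact_integrable _ (cst K)).
    exact: segment_compact.
  by apply: continuous_subspaceT => ?; exact: cvg_cst.
- apply: aeW => s n _ /=; rewrite lee_fin /g normrM gtr0_norm// -ler_pdivlMl//.
  by rewrite mulrC; apply: le_trans (ftK _ _) _;
    rewrite addrAC subrr add0r gtr0_norm ?invr_gt0.
move=> ih _ cvgI.
have : (G n x - G n 0) @[n --> \oo] --> ft x - ft 0.
  apply: cvgB; first exact: (is_derive_seq (dPhi _ (m10 _ (ltW x0)))).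
  exact: (is_derive_seq (dPhi _ (m10 _ (lexx 0)))).
move=> cvgG; rewrite -!ftE ?in_itv/= ?lexx ?(ltW x0) ?(ltW T0)// /Rintegral.
have {}cvgG : (G n x - G n 0)%:E @[n --> \oo] --> (ft x - ft 0)%:E.
  by apply/fine_cvgP; split=> //; exact: nearW.
suff -> : (\int[mu]_(t in `[0%R, x]) (h t)%:E = (ft x - ft 0)%R%:E)%E by [].
apply: (@cvg_unique _ (@ereal_hausdorff R) _ _ _ _ cvgI).
by apply: cvg_trans cvgG; apply: near_eq_cvg; apply: nearW => n /=;
  rewrite intg.
Unshelve. all: by end_near. Qed.
End LipschitzFTC.

(** * Complex-valued functions of a real variable *)

Section ComplexPaths.
Variables (R : realType) (T : R).
Local Notation mu := (@lebesgue_measure R).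
Local Notation A := (ncseries R).
Local Notation G := (ncgroup R).
Local Notation cfun := (R -> R[i]).
Local Notation normc := ComplexField.Normc.normc.
Local Notation Re := complex.Re.
Local Notation Im := complex.Im.
Local Notation rp f := (fun x : R => Re (f x)).
Local Notation ip f := (fun x : R => Im (f x)).
Implicit Types (f g h : cfun).

Lemma normc_Re (z : R[i]) : `|Re z| <= normc z.
Proof.
case: z => x y /=; rewrite -sqrtr_sqr ler_wsqrtr// lerDl sqr_ge0//.
Qed.
Lemma normc_Im (z : R[i]) : `|Im z| <= normc z.
Proof.
case: z => x y /=; rewrite -sqrtr_sqr ler_wsqrtr// lerDr sqr_ge0//.
Qed.
Lemma normc_ge0 (z : R[i]) : 0 <= normc z.
Proof. by case: z => x y; exact: sqrtr_ge0. Qed.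

Lemma ReD (x y : R[i]) : Re (x + y) = Re x + Re y. Proof. by case: x y => ? ? []. Qed.
Lemma ImD (x y : R[i]) : Im (x + y) = Im x + Im y. Proof. by case: x y => ? ? []. Qed.
Lemma ReN (x : R[i]) : Re (- x) = - Re x. Proof. by case: x. Qed.
Lemma ImN (x : R[i]) : Im (- x) = - Im x. Proof. by case: x. Qed.
Lemma ReM (x y : R[i]) : Re (x * y) = Re x * Re y - Im x * Im y.
Proof. by case: x y => ? ? []. Qed.
Lemma ImM (x y : R[i]) : Im (x * y) = Re x * Im y + Im x * Re y.
Proof. by case: x y => ? ? []. Qed.

Lemma is_cderive_cst c x : is_cderive (cst c : cfun) x 0.
Proof. by split; exact: is_derive_cst. Qed.

Lemma is_cderiveD f g x df dg : is_cderive f x df -> is_cderive g x dg ->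
  is_cderive (fun y => f y + g y) x (df + dg).
Proof.
move=> [fr fi] [gr gi]; split.
  rewrite ReD (_ : (fun y => _) = (rp f) \+ (rp g)); first exact: is_deriveD.
  by apply/funext => y /=; rewrite ReD.
rewrite ImD (_ : (fun y => _) = (ip f) \+ (ip g)); first exact: is_deriveD.
by apply/funext => y /=; rewrite ImD.
Qed.

Lemma is_cderiveM f g x df dg : is_cderive f x df -> is_cderive g x dg ->
  is_cderive (fun y => f y * g y) x (df * g x + f x * dg).
Proof.
move=> [fr fi] [gr gi]; split.
  rewrite (_ : rp (fun y => f y * g y) = (rp f \* rp g) \- (ip f \* ip g)).
    have -> : Re (df * g x + f x * dg) = (Re (f x) *: Re dg + Re (g x) *: Re df) -
        (Im (f x) *: Im dg + Im (g x) *: Im df).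
      by rewrite ReD !ReM /GRing.scale/=; ring.
    by apply: is_deriveB; apply: is_deriveM.
  by apply/funext => y /=; rewrite ReM.
rewrite (_ : ip (fun y => f y * g y) = (rp f \* ip g) \+ (ip f \* rp g)).
  have -> : Im (df * g x + f x * dg) = (Re (f x) *: Im dg + Im (g x) *: Re df) +
      (Im (f x) *: Re dg + Re (g x) *: Im df).
    by rewrite ImD !ImM /GRing.scale/=; ring.
  by apply: is_deriveD; apply: is_deriveM.
by apply/funext => y /=; rewrite ImM.
Qed.

Definition clip (D : set R) f := exists K : R, forall x y, D x -> D y ->
  normc (f x - f y) <= K * `|x - y|.

Lemma clip_cst D c : clip D (cst c).
Proof.
by exists 0 => x y _ _; rewrite subrr ComplexField.Normc.normc0 mul0r.
Qed.

Lemma clipD D f g : clip D f -> clip D g -> clip D (fun x => f x + g x).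
Proof.
move=> [K fK] [L gL]; exists (K + L) => x y Dx Dy; rewrite mulrDl opprD addrACA.
apply: le_trans (le_normcD _ _) _.
by rewrite lerD ?fK ?gL.
Qed.

Lemma clip_bounded f : clip `[0, T] f ->
  exists M, forall x, x \in `[0, T] -> normc (f x) <= M.
Proof.
move=> [K fK]; exists (`|K| * `|T| + normc (f 0)) => x xT.
have T0 : 0 \in `[0, T].
  by move: xT; rewrite !in_itv/= lexx => /andP[/le_trans]; apply.
rewrite -[f x](subrK (f 0)); apply: le_trans (le_normcD _ _) _.
rewrite lerD2r; apply: le_trans (fK _ _ xT T0) _; rewrite subr0.
apply: le_trans (_ : `|K| * `|x| <= _); first by rewrite ler_wpM2r// ler_norm.
rewrite ler_wpM2l//; move: xT; rewrite in_itv/= => /andP[x0 xT].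
by rewrite !ger0_norm// (le_trans x0).
Qed.

Lemma clipM f g : clip `[0, T] f -> clip `[0, T] g ->
  clip `[0, T] (fun x => f x * g x).
Proof.
move=> fl gl; have [M fM] := clip_bounded fl; have [N gN] := clip_bounded gl.
case: fl gl => [K fK] [L gL]; exists (`|M| * `|L| + `|K| * `|N|) => x y xT yT.
have -> : f x * g x - f y * g y = f x * (g x - g y) + (f x - f y) * g y by ring.
apply: le_trans (le_normcD _ _) _; rewrite !ComplexField.Normc.normcM mulrDl.
apply: lerD.
  rewrite -mulrA; apply: ler_pM; rewrite ?normc_ge0//.
    exact: le_trans (fM _ xT) (ler_norm _).
  by apply: le_trans (gL _ _ xT yT) _; rewrite ler_wpM2r// ler_norm.
rewrite mulrAC; apply: ler_pM; rewrite ?normc_ge0//.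
  by apply: le_trans (fK _ _ xT yT) _; rewrite ler_wpM2r// ler_norm.
exact: le_trans (gN _ yT) (ler_norm _).
Qed.

Definition cmeasurable f :=
  measurable_fun `[0, T] (rp f) /\ measurable_fun `[0, T] (ip f).

Lemma cmeasurableM f g :
  cmeasurable f -> cmeasurable g -> cmeasurable (fun x => f x * g x).
Proof.
move=> [fr fi] [gr gi]; split.
  rewrite (_ : rp (fun y => f y * g y) = (rp f) \* (rp g) \- (ip f) \* (ip g)).
    by apply: measurable_funB; exact: measurable_funM.
  by apply/funext => x /=; rewrite ReM.
rewrite (_ : ip (fun y => f y * g y) = (rp f) \* (ip g) \+ (ip f) \* (rp g)).
  by apply: measurable_funD; exact: measurable_funM.
by apply/funext => x /=; rewrite ImM.
Qed.

Lemma lipschitz_measurable (f : R -> R) (K : R) :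
  (forall x y, x \in `[0, T] -> y \in `[0, T] ->
    `|f x - f y| <= K * `|x - y|) -> measurable_fun `[0, T] f.
Proof.
move=> fK; apply: subspace_continuous_measurable_fun => //.
apply/subspace_continuousP => x xT; apply/cvgrPdist_lt => e e0.
have d0 : 0 < e / (`|K| + 1) by rewrite divr_gt0// ltr_wpDl.
near=> y.
have yT : y \in `[0, T] by near: y; exact: withinT.
apply: le_lt_trans (fK x y xT yT) _.
apply: (@le_lt_trans _ _ ((`|K| + 1) * `|x - y|)).
  by rewrite ler_wpM2r// (le_trans (ler_norm K))// lerDl.
rewrite mulrC -ltr_pdivlMr; last exact: ltr_wpDl.
by near: y; apply: cvg_within; exact: (nbhsx_ballx x _ d0).
Unshelve. all: by end_near. Qed.

Lemma clip_cmeasurable f : clip `[0, T] f -> cmeasurable f.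
Proof.
move=> [K fK]; split; apply: (@lipschitz_measurable _ K) => x y xT yT /=.
  by rewrite -ReN -ReD; apply: le_trans (normc_Re _) _; exact: fK.
by rewrite -ImN -ImD; apply: le_trans (normc_Im _) _; exact: fK.
Qed.

Lemma lebesgue_aeS (P Q : R -> Prop) : (forall x, P x -> Q x) ->
  {ae mu, forall x, P x} -> {ae mu, forall x, Q x}.
Proof. by apply: filterS; exact: (ae_filter_ringOfSetsType mu). Qed.

Lemma clip_FTC f h : clip `[0, T] f -> cmeasurable h ->
  {ae mu, forall x : R, x \in `[0, T] -> is_cderive f x (h x)} ->
  forall x, x \in `[0, T] -> cintegral `[0, x] h = f x - f 0.
Proof.
move=> [K fK] [hr hi] dfh x xT; rewrite /cintegral.
rewrite (@lipschitz_FTC _ (rp f) (rp h) K T)//; first last.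
- by apply: lebesgue_aeS dfh => y dy /dy[].
- by move=> y z yT zT /=; rewrite -ReN -ReD; apply: le_trans (normc_Re _) _;
  exact: fK.
rewrite (@lipschitz_FTC _ (ip f) (ip h) K T)//; first last.
- by apply: lebesgue_aeS dfh => y dy /dy[].
- by move=> y z yT zT /=; rewrite -ImN -ImD; apply: le_trans (normc_Im _) _;
  exact: fK.
by rewrite /= -ReN -ReD -ImN -ImD; case: (f x - f 0).
Qed.

Lemma eq_cintegral D f g : {in D, f =1 g} -> cintegral D f = cintegral D g.
Proof.
by move=> fg; rewrite /cintegral; congr (_ +i* _);
  apply: eq_Rintegral => x /fg ->.
Qed.

(** This reduces identities along a path to the initial value and an almost everywhere
    derivative. *)
Lemma clip_deriv0 f : clip `[0, T] f ->
  {ae mu, forall x : R, x \in `[0, T] -> is_cderive f x 0} ->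
  forall x, x \in `[0, T] -> f x = f 0.
Proof.
move=> fl df x xT; apply/eqP; rewrite -subr_eq0 -(clip_FTC (h := cst 0) fl)//.
  rewrite /cintegral /=; apply/eqP; congr (_ +i* _);
    by rewrite Rintegral_cst//= mul0r.
Qed.

Section Pointwise.
Variables (D : set R) (x : R).

Definition pderive (F : R -> A) (L : A) :=
  forall w, is_cderive (fun y => F y w) x (L w).
Definition plip (F : R -> A) := forall w, clip D (fun y => F y w).

Lemma pderive_sig j F L : pderive F L -> pderive (sig j \o F) (sig j L).
Proof. by move=> dF w; rewrite /= unlock; exact: dF. Qed.
Lemma plip_sig j F : plip F -> plip (sig j \o F).
Proof. by move=> dF w; rewrite /= unlock; exact: dF. Qed.

Lemma is_cderive_sh u v F L : pderive F L ->
  is_cderive (fun y => sh u v (F y)) x (sh u v L).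
Proof.
elim: u v F L => [|a u IHu] v; first by move=> F L; exact.
elim: v => [|b v IHv] F L dF; first by rewrite shs0; exact: dF.
rewrite sh_cons; apply: is_cderiveD.
  by apply: (IHu _ (sig a \o F)); exact: pderive_sig.
by apply: (IHv (sig b \o F)); exact: pderive_sig.
Qed.
Lemma clip_sh u v F : plip F -> clip D (fun y => sh u v (F y)).
Proof.
elim: u v F => [|a u IHu] v; first by move=> F; exact.
elim: v => [|b v IHv] F dF; first exact: dF.
apply: clipD.
  by apply: (IHu _ (sig a \o F)); exact: plip_sig.
by apply: (IHv (sig b \o F)); exact: plip_sig.
Qed.

Lemma pderive_tau i F L : pderive F L -> pderive (tau i \o F) (tau i L).
Proof. by move=> dF w; rewrite /= tau.unlock; exact: is_cderive_sh. Qed.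
Lemma plip_tau i F : plip F -> plip (tau i \o F).
Proof. by move=> dF w; rewrite /= tau.unlock; exact: clip_sh. Qed.

Lemma pderive_foldl s F L : pderive F L ->
  pderive (fun y => foldl (fun z i => tau i z) (F y) s)
    (foldl (fun z i => tau i z) L s).
Proof.
elim: s F L => [//|i s IH] F L dF /=.
by apply: (IH (tau i \o F)); exact: pderive_tau.
Qed.
Lemma pderive_momop q F L : pderive F L -> pderive (momop q \o F) (momop q L).
Proof.
by move=> dF; exact: (@pderive_foldl q.1 _ _ (@pderive_sig q.2 _ _ dF)).
Qed.
Lemma plip_foldl s F : plip F ->
  plip (fun y => foldl (fun z i => tau i z) (F y) s).
Proof.
by elim: s F => [//|i s IH] F dF /=; apply: (IH (tau i \o F)); exact: plip_tau.
Qed.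
Lemma plip_momop q F : plip F -> plip (momop q \o F).
Proof.
by move=> dF; exact: (@plip_foldl q.1 _ (@plip_sig q.2 _ dF)).
Qed.

Lemma is_cderive_mom qs F L : pderive F L ->
  is_cderive (fun y => mom qs (F y)) x (mom qs L).
Proof.
elim: qs F L => [|q qs IH] F L dF /=; first exact: dF.
by apply: (IH (momop q \o F)); exact: pderive_momop.
Qed.
Lemma clip_mom qs F : plip F -> clip D (fun y => mom qs (F y)).
Proof.
elim: qs F => [|q qs IH] F dF /=; first exact: dF.
by apply: (IH (momop q \o F)); exact: plip_momop.
Qed.

End Pointwise.

End ComplexPaths.

(** * Shuffle relations and moments of path endpoints *)

Section PathSolutions.
Variables (R : realType) (T : R).
Local Notation mu := (@lebesgue_measure R).
Local Notation A := (ncseries R).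
Local Notation G := (ncgroup R).
Local Notation cfun := (R -> R[i]).

(** The field has only one-letter words, so the leading letter of a word is the outermost
    integration of its coefficient. *)
Lemma sig_path_field (a : nat -> cfun) x j (f : A) :
  sig j (path_field a x * f) = a j x *: f.
Proof.
rewrite sig_mul scale0r add0r; have -> : sig j (path_field a x) = a j x *: 1.
  apply/funext => w; rewrite sigE ncscaleE nconeE.
  by case: w => [|b w] /=; rewrite ?mulr1 ?mulr0.
by rewrite -scalerAl mul1r.
Qed.

Definition integrand (d : seq (nat * nat) * nat) : (nat -> cfun) -> cfun :=
  fun a x => (\prod_(q <- d.1) primitive (a q.1) x ^+ q.2) * a d.2 x.
Definition mom_index (d : seq (nat * nat) * nat) : seq nat * nat :=
  (flatten [seq nseq q.2 q.1 | q <- d.1], d.2).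

Lemma foldl_tau_power (s : seq (nat * nat)) (g : A) c :
  (forall i, tau i g = g [:: i] *: g) ->
  foldl (fun z i => tau i z) (c *: g) (flatten [seq nseq q.2 q.1 | q <- s]) =
  (c * \prod_(q <- s) g [:: q.1] ^+ q.2) *: g.
Proof.
move=> g_tau; elim: s c => [|[i n] s IH] c /=.
  by rewrite big_nil mulr1.
rewrite foldl_cat big_cons mulrA -IH /=; congr foldl.
elim: n c => [|n IHn] c /=; first by rewrite expr0 mulr1.
by rewrite linearZ /= g_tau scalerA IHn exprS mulrA.
Qed.

Variables (a : nat -> cfun) (F : R -> G).
Hypotheses (aX : path_space T a) (aF : is_path_solution T a F).
Local Notation vF := (fun x : R => \val (F x) : A).

Lemma solution_plip : plip `[0, T] vF.
Proof. by case: aF => _ + _ w => /(_ w)[K FK]; exists K => x y; exact: FK. Qed.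

Lemma solution_pderive : {ae mu, forall x, x \in `[0, T] ->
  pderive x vF (path_field a x * vF x)}.
Proof. by case: aF. Qed.

Lemma solution0 : vF 0 = 1.
Proof. by case: aF => ->. Qed.

(** Both sides agree at 0. Their derivatives remove the leading letter of [u] or of [v], so they
    agree by induction on the two words. *)
Lemma solution_shuffle u v x : x \in `[0, T] ->
  vF x u * vF x v = sh u v (vF x).
Proof.
elim: u v x => [|i u IHu] v x xT.
  by rewrite sh0s ncval_nil mul1r.
elim: v x xT => [|j v IHv] x xT; first by rewrite shs0 ncval_nil mulr1.
pose h y := vF y (i :: u) * vF y (j :: v) + (-1) * sh (i :: u) (j :: v) (vF y).
have h0 : h 0 = 0.
  have sh1 s t : (0 < size s + size t)%N -> sh s t (1 : A) = 0.
    elim: s t => [|b s IHs] t; first by case: t.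
    elim: t => [|e t IHt] _; first by rewrite shs0.
    have sh00 s' t' : sh s' t' (0 : A) = 0.
      by rewrite -(subrr (0 : A)) shB subrr.
    by rewrite sh_cons !sig1 !sh00 addr0.
  by rewrite /h solution0 nconeE mul0r sh1// mulr0 addr0.
suff hx : h x = h 0.
  by apply/eqP; rewrite -subr_eq0 -mulN1r -/(h x) hx h0.
apply: (@clip_deriv0 _ T h) => //.
  apply: clipD; first by apply: clipM; exact: solution_plip.
  by apply: clipM; [exact: clip_cst | apply: clip_sh; exact: solution_plip].
move: solution_pderive; apply: lebesgue_aeS => y dF yT.
have {}dF := dF yT.
have := is_cderiveD (is_cderiveM (dF (i :: u)) (dF (j :: v)))
  (is_cderiveM (is_cderive_cst (-1) y) (is_cderive_sh (i :: u) (j :: v) dF)).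
rewrite -!sigE !sh_cons !sig_path_field !ncscaleE !sigE.
set l := (X in is_cderive _ _ X -> _); suff -> : l = 0 by [].
have shZ c s t (f : A) : sh s t (c *: f) = c * sh s t f.
  have sh00 : sh s t (0 : A) = 0 by rewrite -(subrr (0 : A)) shB subrr.
  by rewrite -[c *: f]addr0 shP sh00 addr0.
rewrite /l /cst !shZ -IHu// -IHv//; ring.
Qed.

Lemma solution_tau x i : x \in `[0, T] -> tau i (vF x) = vF x [:: i] *: vF x.
Proof.
by move=> xT; apply/funext => w; rewrite tauE -solution_shuffle.
Qed.

Let in_sub x y : x \in `[0, T] -> y \in `[0, x] -> y \in `[0, T].
Proof.
by rewrite !in_itv/= => /andP[x0 xT] /andP[-> /le_trans]; apply.
Qed.

Lemma path_cmeasurable j : cmeasurable T (a j).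
Proof. by case: aX => /(_ j)[]. Qed.

(** The field turns [sig] into multiplication by the scalar [a q.2 y], which passes through all
    later linear operators; then integrate from 0, where moments of positive order vanish. *)
Lemma solution_mom q qs x : x \in `[0, T] ->
  cintegral `[0, x] (fun y => a q.2 y *
    mom qs (foldl (fun z i => tau i z) (vF y) q.1)) = mom (q :: qs) (vF x).
Proof.
move=> xT; have lh := clip_mom qs (plip_foldl q.1 solution_plip).
rewrite (@clip_FTC _ T (fun y => mom (q :: qs) (vF y)))//.
- by rewrite solution0 mom1// subr0.
- exact: clip_mom solution_plip.
- by apply: cmeasurableM; [exact: path_cmeasurable | exact: clip_cmeasurable].
move: solution_pderive; apply: lebesgue_aeS => y dF yT.
have := is_cderive_mom (q :: qs) (dF yT).
rewrite /= {2}/momop sig_path_field.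
have -> : foldl (fun z i => tau i z) (a q.2 y *: vF y) q.1 =
    a q.2 y *: foldl (fun z i => tau i z) (vF y) q.1.
  by elim: q.1 (vF y) => [//|i s IH] f /=; rewrite linearZ IH.
by rewrite momZ.
Qed.

Lemma solution_primitive i x : x \in `[0, T] -> primitive (a i) x = vF x [:: i].
Proof.
move=> xT; have := @solution_mom ([::], i) [::] x xT.
rewrite /= /momop /= sigE => <-; apply: eq_cintegral => y _.
by rewrite ncval_nil mulr1.
Qed.

(** The list is reversed because [iterated_integral] lists integrands from the innermost and [mom]
    from the outermost. By [solution_tau] the solution is an eigenvector of each [tau i] with the
    primitive as eigenvalue, which produces the powers in the integrand. *)
Lemma solution_moment ds x : x \in `[0, T] ->
  iterated_integral (map integrand ds) a x = mom (rev (map mom_index ds)) (vF x).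
Proof.
elim/last_ind: ds x => [|ds d IH] x xT; first by rewrite /= ncval_nil.
rewrite !map_rcons rev_rcons -solution_mom// /iterated_integral foldl_rcons.
apply: eq_cintegral => y; rewrite inE => yx; have yT := in_sub xT yx.
rewrite -/(iterated_integral _ a y) IH//.
have := foldl_tau_power d.1 1 (fun i => solution_tau i yT).
rewrite scale1r mul1r => ->; rewrite momZ mulrCA mulrA; congr (_ * _).
rewrite /integrand; congr (_ * _); apply: eq_bigr => q _.
by rewrite solution_primitive.
Qed.

End PathSolutions.

(** * Piecewise constant paths *)

Section StepPaths.
Variable R : realType.
Local Notation mu := (@lebesgue_measure R).
Local Notation A := (ncseries R).
Local Notation G := (ncgroup R).
Local Notation cfun := (R -> R[i]).
Local Notation normc := ComplexField.Normc.normc.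
Local Notation Re := complex.Re.
Local Notation Im := complex.Im.
Local Notation rp f := (fun x : R => Re (f x)).
Local Notation ip f := (fun x : R => Im (f x)).
Local Notation ncvar := (@ncvar R).
Implicit Types (f g h : cfun).

Lemma eq_is_cderive f g x l :
  f =1 g -> is_cderive g x l -> is_cderive f x l.
Proof. by move=> /funext ->. Qed.
Lemma eq_clip D f g : f =1 g -> clip D g -> clip D f.
Proof. by move=> /funext ->. Qed.

Lemma pderive_mulr x (F : R -> A) (L g : A) :
  pderive x F L -> pderive x (fun y => F y * g) (L * g).
Proof.
move=> dF w /=; elim: w F L dF => [|j w IH] F L dF.
  apply: (eq_is_cderive (fun y => ncmul0E _ _)); rewrite ncmul0E;
    have := is_cderiveM (dF [::]) (is_cderive_cst (g [::]) x).
  by rewrite mulr0 addr0.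
apply: (@eq_is_cderive _ (fun y => F y [::] * sig j g w + (sig j (F y) * g) w)).
  by move=> y; rewrite -sigE sig_mul ncaddE ncscaleE.
rewrite -sigE sig_mul ncaddE ncscaleE; apply: is_cderiveD.
  have := is_cderiveM (dF [::]) (is_cderive_cst (sig j g w) x).
  by rewrite mulr0 addr0.
by apply: (IH (sig j \o F)); exact: pderive_sig.
Qed.

Lemma plip_mulr (s : R) (F : R -> A) (g : A) :
  plip `[0, s] F -> plip `[0, s] (fun y => F y * g).
Proof.
move=> dF w /=; elim: w F dF => [|j w IH] F dF.
  apply: (eq_clip (fun y => ncmul0E _ _)).
  by apply: clipM; [exact: dF | exact: clip_cst].
apply: (@eq_clip _ _ (fun y => F y [::] * sig j g w + (sig j (F y) * g) w)).
  by move=> y; rewrite -sigE sig_mul ncaddE ncscaleE.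
apply: clipD; first by apply: clipM; [exact: dF | exact: clip_cst].
by apply: (IH (sig j \o F)); exact: plip_sig.
Qed.

Lemma is_cderive_affine (r : R[i]) (m x : R) :
  is_cderive (fun y => r * (y - m)%:C) x r.
Proof.
have d1 : is_cderive (fun y => (y - m)%:C) x 1.
  split => /=; last exact: is_derive_cst.
  rewrite -[1 in X in is_derive _ _ _ X]subr0.
  exact: is_deriveB.
have := is_cderiveM (is_cderive_cst r x) d1.
by rewrite mul0r add0r mulr1.
Qed.

Lemma is_cderiveX f x df n : is_cderive f x df ->
  is_cderive (fun y => f y ^+ n.+1) x (n.+1%:R * f x ^+ n * df).
Proof.
move=> dff; elim: n => [|n IH].
  by apply: eq_is_cderive (fun y => expr1 _) _; rewrite expr0 !mul1r.
apply: eq_is_cderive (fun y => exprS _ _) _.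
have := is_cderiveM dff IH.
set l := (X in is_cderive _ _ X -> _) => dl.
suff <- : l = n.+2%:R * f x ^+ n.+1 * df by [].
by rewrite /l -[n.+2]addn1 natrD !exprS; ring.
Qed.

Lemma pderive_ncexp (r : R[i]) (m x : R) i :
  pderive x (fun y => ncexp (r * (y - m)%:C) i)
    ((r *: ncvar i) * ncexp (r * (x - m)%:C) i).
Proof.
move=> [|j w].
  apply: eq_is_cderive (fun y => ncexp_subproof _ _) _.
  rewrite ncmul0E ncscaleE /ncvar /= mulr0 mul0r; exact: is_cderive_cst.
rewrite -scalerAl ncscaleE ncvar_mul_cons /ncexp /=.
case: (j == i) => /=; last by rewrite mul0r mulr0; exact: is_cderive_cst.
case: (all _ _) => /=; last by rewrite !mulr0; exact: is_cderive_cst.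
rewrite mul1r; set n := size w.
have dz := is_cderiveX n (is_cderive_affine r m x).
have := is_cderiveM dz (is_cderive_cst (n.+1`!%:R^-1) x).
rewrite mulr0 addr0 /cst; set l := (X in is_cderive _ _ X -> _) => dl.
suff <- : l = r * ((r * (x - m)%:C) ^+ n / n`!%:R) by [].
rewrite /l factS natrM invfM.
have nz : n.+1%:R != 0 :> R[i] by rewrite pnatr_eq0.
have fz : n`!%:R != 0 :> R[i] by rewrite pnatr_eq0 -lt0n fact_gt0.
move: n.+1%:R n`!%:R nz fz => p q nz fz.
by field; rewrite nz fz.
Qed.

Lemma plip_ncexp (s : R) (r : R[i]) (m : R) i :
  plip `[0, s] (fun y => ncexp (r * (y - m)%:C) i).
Proof.
move=> w; rewrite /ncexp; case: (all _ _); last exact: clip_cst.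
apply: clipM; last exact: clip_cst.
elim: (size w) => [|n IH]; first by exact: clip_cst.
apply: eq_clip (fun y => exprS _ _) _.
apply: clipM => //; exists (normc r) => x y _ _.
have -> : r * (x - m)%:C - r * (y - m)%:C = r * (x - y)%:C.
  by rewrite -mulrBr -rmorphB; congr (_ * _%:C); ring.
rewrite ComplexField.Normc.normcM.
by rewrite /= expr0n/= addr0 sqrtr_sqr.
Qed.

Lemma clip_glue (s m : R) f g : 0 <= m -> m <= s -> f m = g m ->
  clip `[0, m] f -> clip `[0, s] g ->
  clip `[0, s] (fun x => if x <= m then f x else g x).
Proof.
move=> m0 ms fg [K fK] [L gL]; exists (`|K| + `|L|).
have fK' x y : x \in `[0, m] -> y \in `[0, m] ->
    normc (f x - f y) <= `|K| * `|x - y|.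
  move=> xm ym; apply: le_trans (fK _ _ xm ym) _.
  by rewrite ler_wpM2r// ler_norm.
have gL' x y : x \in `[0, s] -> y \in `[0, s] ->
    normc (g x - g y) <= `|L| * `|x - y|.
  move=> xm ym; apply: le_trans (gL _ _ xm ym) _.
  by rewrite ler_wpM2r// ler_norm.
have mixed x y : x \in `[0, s] -> y \in `[0, s] -> x <= m -> m < y ->
    normc (f x - g y) <= (`|K| + `|L|) * `|x - y|.
  rewrite !in_itv/= => /andP[x0 xs] /andP[y0 ys] xm my.
  have -> : f x - g y = (f x - f m) + (g m - g y) by rewrite fg; ring.
  apply: le_trans (le_normcD _ _) _; rewrite mulrDl; apply: lerD.
    apply: le_trans (fK' _ _ _ _) _; rewrite ?in_itv/= ?x0 ?xm ?m0 ?lexx//.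
    rewrite ler_wpM2l// [leLHS]distrC [leRHS]distrC.
    by rewrite !ger0_norm ?subr_ge0// ?lerB// ltW// (le_lt_trans xm).
  apply: le_trans (gL' _ _ _ _) _; rewrite ?in_itv/= ?y0 ?ys ?m0 ?ms//.
  rewrite ler_wpM2l// [leLHS]distrC [leRHS]distrC.
  by rewrite !ger0_norm ?subr_ge0// ?lerB// ltW// (le_lt_trans xm).
move=> x y /= xs ys; have [xm|xm] := leP x m; have [ym|ym] := leP y m.
- apply: le_trans (fK' _ _ _ _) _; last by rewrite ler_wpM2r// lerDl.
    by move: xs; rewrite !in_itv/= xm => /andP[->].
  by move: ys; rewrite !in_itv/= ym => /andP[->].
- exact: mixed.
- by rewrite distrC -opprB normcN; exact: mixed.
- by apply: le_trans (gL' _ _ xs ys) _; rewrite ler_wpM2r// lerDr.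
Qed.

Lemma pderive_near x (F H : R -> A) L : (\near x, F x = H x) ->
  pderive x F L -> pderive x H L.
Proof.
move=> FH dF w; have [dr di] := dF w; split.
  by apply: near_eq_is_derive dr; apply: filterS FH => y ->.
by apply: near_eq_is_derive di; apply: filterS FH => y ->.
Qed.

Lemma measurable_glue (m : R) (f g : R -> R) :
  measurable_fun [set: R] f -> measurable_fun [set: R] g ->
  measurable_fun [set: R] (fun x : R => if x < m then f x else g x).
Proof.
move=> mf mg; apply: measurable_fun_ifT => //.
exact: measurable_fun_ltr.
Qed.

(** The first half of the interval runs a path for the tail of the list; the second moves at
    constant speed along one variable, which multiplies by an exponential on the left. *)
Lemma step_path l (s : R) : 0 < s -> exists (a : nat -> cfun) (F : R -> G),
  [/\ forall i, measurable_fun [set: R] (rp (a i)) /\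
        measurable_fun [set: R] (ip (a i)),
      exists C : R, forall i x, normc (a i x) <= C,
      F 0 = 1%g /\ F s = exp_prod l,
      plip `[0, s] (fun y => \val (F y)) &
      {ae mu, forall x : R, x \in `[0, s] ->
        pderive x (fun y => \val (F y)) (path_field a x * \val (F x))}].
Proof.
elim: l s => [|[c i] l IH] s s0.
  exists (fun _ => cst 0), (cst 1%g); split=> //.
  - by exists 0 => i x; rewrite ComplexField.Normc.normc0.
  - by move=> w; exact: clip_cst.
  - apply: aeW => x _ w.
    rewrite [X in is_cderive _ _ X](_ : _ = 0); first exact: is_cderive_cst.
    have -> : path_field (fun=> cst 0) x * \val (cst 1%g x : G) =
        path_field (fun=> cst 0) x :> A by exact: mulr1.
    by case: w => [|j []].
pose m := s / 2; have m0 : 0 < m by rewrite divr_gt0.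
have ms : m < s by rewrite /m; lra.
have [a [F [am [C aC] [F0 Fm] Flip Fd]]] := IH m m0.
(* The remaining time is again [m], so this speed ends at exponent [c]. *)
pose r := c / m%:C.
pose b (j : nat) (x : R) : R[i] :=
  if x < m then a j x else if j == i then r else 0.
pose H (x : R) : G := (gexp (r * (x - m)%:C)%R i * F m)%g.
pose E (x : R) : G := if x <= m then F x else H x.
have Hm : H m = F m.
  rewrite /H subrr mulr0; apply: val_inj.
  by rewrite /= ncexp0 mul1r.
have mC : m%:C != 0 by rewrite eq_complex /= eqxx andbT gt_eqF.
exists b, E; split.
- move=> j; have [aj1 aj2] := am j; split.
    rewrite (_ : rp (b j) = fun x => if x < m then Re (a j x) else
      Re (if j == i then r else 0)).
      by apply: measurable_glue => //; exact: measurable_cst.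
    by apply/funext => x; rewrite /b; case: ifP.
  rewrite (_ : ip (b j) = fun x => if x < m then Im (a j x) else
    Im (if j == i then r else 0)).
    by apply: measurable_glue => //; exact: measurable_cst.
  by apply/funext => x; rewrite /b; case: ifP.
- exists (`|C| + normc r) => j x; rewrite /b; case: ifP => _.
    by rewrite (le_trans (aC _ _))// (le_trans (ler_norm _))// lerDl normc_ge0.
  case: ifP => _; first by rewrite lerDr.
  by rewrite ComplexField.Normc.normc0 addr_ge0// normc_ge0.
- rewrite /E (ltW m0) leNgt ms; split=> //=.
  rewrite /H Fm /r; congr (gexp _ i * _)%g.
  have -> : s - m = m by rewrite /m; lra.
  by rewrite mulfVK.
- move=> w; rewrite (_ : (fun y => _) =
    fun x => if x <= m then \val (F x) w else \val (H x) w); last first.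
    by apply/funext => x; rewrite /E; case: ifP.
  apply: clip_glue => //; rewrite ?(ltW m0) ?(ltW ms) ?Hm//.
  by apply: plip_mulr; exact: plip_ncexp.
(* At the junction the derivative may jump, but a single point is a null set. *)
have aem : {ae mu, forall x, x != m}.
  exists [set m]; split => //; first exact: lebesgue_measure_set1.
  by move=> x /= /negP; rewrite negbK => /eqP.
move: aem Fd; apply: filterS2; first exact: (ae_filter_ringOfSetsType mu).
move=> x xm dF; rewrite in_itv/= => /andP[x0 xs].
have [xltm|mltx|xem] := ltgtP x m; last by rewrite xem eqxx in xm.
  have -> : path_field b x = path_field a x.
    by apply/funext => -[|j []]//; rewrite /path_field /b xltm.
  have -> : E x = F x by rewrite /E ltW.
  have xin : x \in `[0, m] by rewrite in_itv/= x0 ltW.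
  apply: pderive_near (dF xin).
  by near=> y; rewrite /E ifT//; apply: ltW; near: y; exact: lt_nbhsl.
have -> : path_field b x = r *: ncvar i.
  apply/funext => -[|j [|? ?]]; rewrite ncscaleE /ncvar /= ?mulr0//.
    rewrite /b ltNge (ltW mltx) /= eqseq_cons andbT.
    by case: ifP; rewrite ?mulr1 ?mulr0.
  by rewrite eqseq_cons andbF mulr0.
have -> : E x = H x by rewrite /E leNgt mltx.
have dH : pderive x (fun y => \val (H y)) ((r *: ncvar i) * \val (H x)).
  by rewrite /H ncvalM mulrA; apply: pderive_mulr; exact: pderive_ncexp.
apply: pderive_near dH.
by near=> y; rewrite /E ifF//; apply/negbTE; rewrite -ltNge; near: y;
  exact: lt_nbhsr.
Unshelve. all: by end_near. Qed.

Variables (T : R) (T0 : 0 < T).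

Lemma exp_group_endpoint x : exp_group x ->
  exists2 a, path_space T a & path_endpoint T a x.
Proof.
move=> [l _ <-]; have [a [F [am [C aC] [F0 FT] Flip Fd]]] := step_path l T0.
exists a; last first.
  exists F; last by rewrite FT.
  split; [exact: F0| |exact: Fd].
  by move=> w; have [K FK] := Flip w; exists K => y z yT zT; exact: FK.
split.
  by move=> i; have [ar ai] := am i; split; exact: measurable_funTS.
(* A bound of at least 1 dominates all its own roots, hence is uniform in [i]. *)
exists (1 + `|C|) => i; apply: aeW => y _.
have aC1 : normc (a i y) <= 1 + `|C|.
  by rewrite (le_trans (aC _ _))// (le_trans (ler_norm _))// lerDr.
apply: (@le_trans _ _ ((1 + `|C|) `^ (i.+1%:R^-1))).
  by apply: ge0_ler_powR; rewrite ?nnegrE ?invr_ge0// ?normc_ge0// addr_ge0.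
rewrite -[leRHS]powRr1 ?addr_ge0//; apply: ler_powR; first by rewrite lerDl.
by rewrite invf_le1// ler1n.
Qed.

End StepPaths.

(** * Closures *)

Section CoefficientTopology.
Variable R : realType.
Local Notation A := (ncseries R).
Local Notation G := (ncgroup R).

Lemma coef_continuous w : continuous (fun g : G => (\val g : A) w : R[i]^o).
Proof.
move=> g.
apply: (@continuous_comp G A R[i]^o (fun x : G => \val x : A) (fun f => f w)).
  exact: (@initial_continuous G A (fun x : G => \val x : A)).
exact: (@proj_continuous _ (fun _ : seq nat => R[i]^o) w).
Qed.

(** Every word has length at most [m] and letters below [m] for large [m], so the chosen elements
    converge to [g] coefficientwise. *)
Lemma closure_agree (S : set G) (g : G) :
  (forall m, exists2 h, S h & forall w, (size w <= m)%N -> letters m w ->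
    (\val h : A) w = (\val g : A) w) -> closure S g.
Proof.
move=> Sg; have /choice[u uP] : forall m, exists h, S h /\
    forall w, (size w <= m)%N -> letters m w ->
      (\val h : A) w = (\val g : A) w.
  by move=> m; have [h hS hg] := Sg m; exists h.
suff cvg_u : u @ \oo --> g.
  move=> B gB; have /filter_ex[m um] : \forall m \near \oo, B (u m).
    exact: cvg_u.
  by exists (u m); split=> //; have [] := uP m.
have cvg_val : (fun m => \val (u m) : A) @ \oo --> (\val g : A).
  apply/cvg_sup => w U /= [_ [[W _ <-] /= Wg] /filterS]; apply.
  rewrite nbhs_filterE; exists (\max_(i <- size w :: w) i.+1) => // m /= wm.
  have bound i : i \in size w :: w -> (i < m)%N.
    by move=> iw; apply: leq_trans wm;
      exact: (@leq_bigmax_seq _ _ xpredT (fun i => i.+1)).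
  have [_ ->//] := uP m; first by rewrite ltnW// bound// mem_head.
  by apply/allP => i iw; apply: bound; rewrite in_cons iw orbT.
move=> B /= [_ [[W oW <-] Wg] /filterS]; apply.
by apply: cvg_val; exact: open_nbhs_nbhs.
Qed.

(** Continuity of [phi] is asked on [D] only, as for moments, which are determined only on the
    formal path group. *)
Lemma closure_within_eq (S D : set G) (phi psi : G -> R[i]^o) g :
  S `<=` D -> {within D, continuous phi} -> continuous psi ->
  (forall h, S h -> phi h = psi h) -> closure S g -> D g -> phi g = psi g.
Proof.
move=> SD phic psic Seq; rewrite closureEcvg => -[F FF [Fg SF]] Dg.
have FS : F S by apply: SF.
have phiF : phi @ F --> phi g.
  apply: cvg_trans (_ : phi @ within D (nbhs g) --> phi g).
    by move=> B; rewrite /= !nbhs_filterE => /Fg;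
      apply: filterS2 FS => h /SD Dh; apply.
  by move/subspace_continuousP : phic; apply.
apply: (@cvg_unique _ (@norm_hausdorff _ R[i]^o) _ _ _ _ phiF).
have psiF : psi @ F --> psi g by move=> B /psic/Fg.
apply: cvg_trans psiF; apply: near_eq_cvg.
by apply: filterS FS => h /Seq.
Qed.

Lemma closure_eq (S : set G) (phi psi : G -> R[i]^o) g :
  continuous phi -> continuous psi ->
  (forall h, S h -> phi h = psi h) -> closure S g -> phi g = psi g.
Proof.
move=> phic psic Seq Sg.
exact: (@closure_within_eq S setT phi psi g (fun _ _ => I)
  (continuous_subspaceT phic) psic Seq Sg I).
Qed.

Lemma complex_continuousD (phi psi : G -> R[i]^o) :
  continuous phi -> continuous psi ->
    continuous (fun g => phi g + psi g : R[i]^o).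
Proof. by move=> phic psic g; exact: (cvgD (phic g) (psic g)). Qed.

Lemma complex_continuousM (phi psi : G -> R[i]^o) :
  continuous phi -> continuous psi ->
    continuous (fun g => phi g * psi g : R[i]^o).
Proof. by move=> phic psic g; exact: (cvgM (phic g) (psic g)). Qed.

Definition coef_cont (X : G ->
  A) := forall w, continuous (fun g => X g w : R[i]^o).

Lemma coef_cont_sig j X : coef_cont X -> coef_cont (sig j \o X).
Proof. by move=> Xc w; rewrite /= unlock; exact: Xc. Qed.

Lemma sh_continuous u v X : coef_cont X ->
  continuous (fun g => sh u v (X g) : R[i]^o).
Proof.
elim: u v X => [|a u IHu] v; first by move=> X; exact.
elim: v => [|b v IHv] X Xc; first exact: Xc.
have cu := IHu (b :: v) _ (@coef_cont_sig a X Xc).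
have cv := IHv _ (@coef_cont_sig b X Xc).
exact: complex_continuousD cu cv.
Qed.

Lemma coef_cont_tau i X : coef_cont X -> coef_cont (tau i \o X).
Proof. by move=> Xc w; rewrite /= tau.unlock; exact: sh_continuous. Qed.

Lemma coef_cont_momop q X : coef_cont X -> coef_cont (momop q \o X).
Proof.
move=> /(@coef_cont_sig q.2); rewrite /momop /comp.
suff gen s (Y : G -> A) : coef_cont Y ->
  coef_cont (fun g => foldl (fun z i => tau i z) (Y g) s) by exact: gen.
elim: s Y => [//|i s IH] Y Yc /=; apply: (IH (tau i \o Y)).
exact: coef_cont_tau.
Qed.

Lemma mom_continuous qs X : coef_cont X ->
  continuous (fun g => mom qs (X g) : R[i]^o).
Proof.
elim: qs X => [|q qs IH] X Xc /=; first exact: Xc.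
by apply: (IH (momop q \o X)); exact: coef_cont_momop.
Qed.

End CoefficientTopology.

(** * The coefficients on which a moment depends *)

Section WordSupport.
Variable R : realType.
Local Notation A := (ncseries R).
Implicit Types f g : A.

Lemma foldl_tau_ext s f g v : (forall w, perm_eq w (s ++ v) -> f w = g w) ->
  foldl (fun z i => tau i z) f s v = foldl (fun z i => tau i z) g s v.
Proof.
elim: s f g => [|i s IH] f g fg /=; first exact: fg.
apply: IH => w wsv; rewrite !tauE; apply: sh_ext => x xw; apply: fg.
by apply: perm_trans xw _; rewrite /= perm_cons.
Qed.

Definition mom_word (qs : seq (seq nat * nat)) : seq nat :=
  flatten [seq q.2 :: q.1 | q <- qs].

(** A moment reads only rearrangements of one word, so it does not mix homogeneous components. *)
Lemma mom_ext qs f g : (forall w, perm_eq w (mom_word qs) -> f w = g w) ->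
  mom qs f = mom qs g.
Proof.
elim: qs f g => [|q qs IH] f g fg /=; first exact: fg.
apply: IH => w wq; apply: foldl_tau_ext => x xw; rewrite !sigE; apply: fg.
by rewrite /= perm_cons; apply: perm_trans xw _; rewrite perm_cat2l.
Qed.

End WordSupport.

(** * Approximating formal closed paths by iterated commutators *)

Section Approximation.
Variables (R : realType) (T : R).
Hypothesis T0 : 0 < T.
Local Notation A := (ncseries R).
Local Notation G := (ncgroup R).
Local Notation K := (closed_path_group T).
Local Notation K0 := (@closed_exp_group R).
Local Notation integrand := (@integrand R).
Implicit Types g h : G.

Let inT : T \in `[0, T]. Proof. by rewrite in_itv/= lexx ltW. Qed.

(** The coefficients of [g] form a character of the shuffle algebra; equivalently, [g] is
    group-like. *)
Definition shuffle_char g :=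
  forall u v, (\val g : A) u * (\val g : A) v = sh u v (\val g).

Lemma endpoint_shuffle a g :
  path_space T a -> path_endpoint T a g -> shuffle_char g.
Proof. by move=> aX [F aF ->] u v; exact: (solution_shuffle aF _ _ inT). Qed.

Lemma endpoint_moment a g ds : path_space T a -> path_endpoint T a g ->
  iterated_integral (map integrand ds) a T =
  mom (rev (map mom_index ds)) (\val g : A).
Proof. by move=> aX [F aF ->]; exact: (solution_moment aX aF _ inT). Qed.

Lemma endpoint_primitive a g i : path_space T a -> path_endpoint T a g ->
  primitive (a i) T = (\val g : A) [:: i].
Proof. by move=> aX [F aF ->]; exact: (solution_primitive aX aF _ inT). Qed.

Lemma closed_exp_group_sub : K0 `<=` K.
Proof.
move=> g [gG g0]; have [a aX ag] := exp_group_endpoint T0 gG.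
exists a => //; split=> // i.
by rewrite -[LHS]/(primitive (a i) T) (endpoint_primitive i aX ag).
Qed.

Lemma closed_path_group_sub : K `<=` path_group T.
Proof. by move=> g [a [aX _] ag]; exists a. Qed.

Lemma closed_path_coef1 g i : K g -> (\val g : A) [:: i] = 0.
Proof. by move=> [a [aX a0] ag]; rewrite -(endpoint_primitive i aX ag);
  exact: a0. Qed.

Lemma closure_coef1 g i : closure K g -> (\val g : A) [:: i] = 0.
Proof.
apply: (@closure_eq _ _ (fun g => (\val g : A) [:: i]) (cst 0)).
- exact: coef_continuous.
- exact: cst_continuous.
- by move=> h /closed_path_coef1.
Qed.

Lemma closure_shuffle g : closure K g -> shuffle_char g.
Proof.
move=> Kg u v; move: Kg; apply: (@closure_eq _ _
  (fun g => (\val g : A) u * (\val g : A) v) (fun g => sh u v (\val g : A))).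
- by apply: complex_continuousM; exact: coef_continuous.
- by apply: sh_continuous => w; exact: coef_continuous.
- by move=> h [a [aX _] ag]; exact: endpoint_shuffle aX ag u v.
Qed.

Lemma shuffle_closed g : shuffle_char g ->
  (forall i, (\val g : A) [:: i] = 0) -> nc_closed (\val g : A).
Proof.
by move=> gsh g1 i; apply/funext => w; rewrite tauE -gsh g1 mul0r.
Qed.

Lemma closure_closed g : closure K g -> nc_closed (\val g : A).
Proof.
move=> Kg; apply: shuffle_closed; first exact: closure_shuffle.
by move=> i; exact: closure_coef1.
Qed.

(** Induction on the length [D]: a right factor whose leading term is the first discrepancy corrects
    [h] at length [D.+1] and leaves shorter words alone. *)
Lemma moments_approx n N D g : shuffle_char g ->
  (forall i, (\val g : A) [:: i] = 0) ->
  (forall qs, (0 < size qs <= n)%N -> mom qs (\val g : A) = 0) ->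
  exists2 h, lower_central K0 n h & forall w, (size w <= D)%N -> letters N w ->
    (\val h : A) w = (\val g : A) w.
Proof.
move=> gsh g1 gmom; have K0G := @closed_exp_group_subgroup R.
have [lc1 lcM _] := lower_central_subgroup n K0G.
elim: D => [|D [h hn hg]].
  by exists 1%g => // w; rewrite leqn0 size_eq0 => /eqP -> _;
    rewrite !ncval_nil.
(* Length 1 is treated apart, because [shuffle_lie] gives membership in L' only from degree 2 on;
   there the linear coefficients of [g] and of 1 both vanish. *)
have [D0|D0] := posnP D.
  rewrite D0; exists 1%g => // -[|i [|//]] _ _; first by rewrite !ncval_nil.
  by rewrite g1.
have hK0 : K0 h.
  have sub m : lower_central K0 m `<=` K0.
    by elim: m => [//|m IH] x /(lower_centralS K0G); exact: IH.
  exact: sub hn.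
have hK := closed_exp_group_sub hK0.
have hsh : shuffle_char h by exact/closure_shuffle/subset_closure.
have hmom qs : (0 < size qs <= n)%N -> mom qs (\val h : A) = 0.
  move=> /andP[q0 qn].
  have [] := @lower_central_moments R K0 n _ h hn.
    by move=> x /closed_exp_group_sub/subset_closure/closure_closed.
  by move=> _ /(_ qs qn); rewrite momB mom1// subr0.
pose good w := (size w == D.+1) && letters N w.
pose P : A := fun w => if good w then (\val g : A) w - (\val h : A) w else 0.
have good_perm w v : perm_eq w v -> good w = good v.
  by move=> wv; rewrite /good (perm_size wv) /letters (perm_all _ wv).
(* Being [good] is invariant under rearrangement, so on the rearrangements of one word [P] is either
   the full difference or zero. *)
have Pext v : (forall w, perm_eq w v -> P w = (\val g - \val h) w) \/
    (forall w, perm_eq w v -> P w = (0 : A) w).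
  have [gv|gv] := boolP (good v); [left|right] => w wv.
    by rewrite /P (good_perm _ _ wv) gv.
  by rewrite /P (good_perm _ _ wv) (negPf gv).
have Phomog : nchomog N D.+1 P by move=> w wD; rewrite /P /good (negPf wD).
(* Both words are nonempty, hence of length at most [D], where [g] and [h] agree; the shuffle
   relations then equate the two sums. *)
have Psh s t : (0 < size s)%N -> (0 < size t)%N -> sh s t P = 0.
  move=> s0 t0; have sh0 : sh s t (0 : A) = 0 by rewrite -(subrr 0) shB subrr.
  have [gst|gst] := boolP (good (s ++ t)); last first.
    rewrite -sh0; apply: sh_ext => w wst.
    by rewrite /P (good_perm _ _ wst) (negPf gst).
  transitivity (sh s t (\val g - \val h : A)).
    by apply: sh_ext => w wst; rewrite /P (good_perm _ _ wst) gst.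
  move: gst; rewrite /good size_cat /letters all_cat => /andP[/eqP stD /andP[sN tN]].
  rewrite shB -gsh -hsh !hg ?subrr//; lia.
have [_ /(_ D0) P1] := shuffle_lie Phomog Psh.
have Pmom qs : (0 < size qs <= n)%N -> mom qs P = 0.
  move=> qn; have [PE|PE] := Pext (mom_word qs); rewrite (mom_ext PE).
    by rewrite momB gmom// hmom// subrr.
  exact: mom0.
have [x xn xP] := lie_realization (lie_moments P1 Pmom) 1.
exists (h * x)%g; first exact: lcM.
move=> w wD wN.
(* As [h] has constant term 1 and [x] leads with [P], the remaining terms start at length [D.+2]. *)
have -> : (\val (h * x)%g : A) w = (\val h : A) w + P w.
  have -> : \val (h * x)%g = \val h + P + ((\val h - 1) * P +
      \val h * (\val x - 1 - 1 *: P)) :> A.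
    rewrite ncvalM scale1r !mulrBr mulrBl mul1r mulr1; apply/funext => v.
    by rewrite !(ncaddE, ncoppE); ring.
  rewrite [LHS]ncaddE [X in _ + X](_ : _ = 0) ?addr0//.
  have PD : ncord D.+1 P by move=> v vD; rewrite Phomog// negb_and neq_ltn vD.
  suff : ncord D.+2 ((\val h - 1) * P + \val h * (\val x - 1 - 1 *: P)) by apply.
  apply: ncordD; first by rewrite -add1n; apply: ncordM => //; exact: ncord_val.
  by rewrite -[D.+2]add0n; apply: ncordM.
have [wD'|wD'] := leqP (size w) D.
  by rewrite Phomog ?addr0 ?hg// negb_and neq_ltn ltnS wD'.
rewrite /P /good ifT; first by rewrite addrC subrK.
by rewrite wN andbT eqn_leq wD wD'.
Qed.

Lemma closure_lower_central n g :
  closure (lower_central (closure K) n) g ->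
  forall qs, (0 < size qs <= n)%N -> mom qs (\val g : A) = 0.
Proof.
move=> Kg qs /andP[q0 qn]; move: Kg.
apply: (@closure_eq _ _ (fun g => mom qs (\val g : A)) (cst 0)).
- by apply: mom_continuous => w; exact: coef_continuous.
- exact: cst_continuous.
move=> h /(lower_central_moments closure_closed)[_ /(_ qs qn)].
by rewrite momB mom1// subr0.
Qed.

Lemma moments_closure n g : closure K g ->
  (forall qs, (0 < size qs <= n)%N -> mom qs (\val g : A) = 0) ->
  closure (lower_central K n) g.
Proof.
move=> Kg gmom; apply: closure_agree => m.
have [h hn hg] := moments_approx m m (closure_shuffle Kg)
  (fun i => closure_coef1 i Kg) gmom.
by exists h => //; exact: lower_central_sub closed_exp_group_sub _ hn.
Qed.

Lemma formal_closed_path_groupE : formal_closed_path_group T = closure K.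
Proof.
apply/seteqP; split=> [g []//|g Kg]; split=> //.
exact: closureS closed_path_group_sub _ Kg.
Qed.

(** Both sides are continuous on the formal path group and agree on endpoints of paths, which are
    dense in it. *)
Lemma formal_moment_eq k mh g : is_formal_moment T k mh ->
  formal_path_group T g ->
  exists2 qs, (0 < size qs)%N /\ size qs = k & mh g = mom qs (\val g : A).
Proof.
move=> [m [[k0 [ps [psP ->]]] mhc mhE]] gG.
have /choice[ds dsE] : forall l, exists d, tnth ps l = integrand d.
  by move=> l; have [s [j ->]] := psP l; exists (s, j).
have psE : tval ps = map integrand (codom ds).
  rewrite -map_comp -[tval ps]map_tnth_enum; apply: eq_map => l.
  exact: dsE.
exists (rev (map mom_index (codom ds))).
  by rewrite size_rev size_map size_codom card_ord.
set qs := rev _.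
have momc : continuous (fun g : G => mom qs (\val g : A) : R[i]^o).
  by apply: mom_continuous => w; exact: coef_continuous.
have mh_mom h : path_group T h -> mh h = mom qs (\val h : A).
  by move=> [a aX ah]; rewrite (mhE _ _ aX ah) psE (endpoint_moment _ aX ah).
exact: (closure_within_eq (@subset_closure _ _) mhc momc mh_mom gG gG).
Qed.

Lemma mom_formal_moment qs : (0 < size qs)%N ->
  is_formal_moment T (size qs) (fun g => mom qs (\val g : A)).
Proof.
(* Each primitive is taken with exponent 1, repetitions staying in the list; the reversal restores
   the innermost-first order. *)
move=> q0; pose ds := [seq ([seq (i, 1%N) | i <- q.1], q.2) | q <- rev qs].
have dsE : rev (map mom_index ds) = qs.
  rewrite -map_comp -map_rev revK -[RHS]map_id; apply: eq_map => -[s j].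
  by rewrite /mom_index /= -map_comp; congr (_, _); elim: s => //= i s ->.
have dsn : size (map integrand ds) == size qs by rewrite !size_map size_rev.
exists (fun a => iterated_integral (map integrand ds) a T); split.
- split=> //; exists (Tuple dsn); split=> // l.
  rewrite (tnth_nth (integrand ([::], 0%N))) /= (nth_map ([::], 0%N));
    last first.
    by move: dsn; rewrite size_map => /eqP ->.
  by case: (nth _ _ _) => s j; exists s, j.
- apply: continuous_subspaceT; apply: mom_continuous => w.
  exact: coef_continuous.
- by move=> a g aX ag; rewrite (endpoint_moment _ aX ag) dsE.
Qed.

End Approximation.

Theorem theorem2p19 (R : realType) (T : R) (hT : 0 < T) (n : nat)
    (hn : (0 < n)%N) :
  (forall g : ncgroup R, formal_closed_path_group T g ->
    (closure_in (formal_closed_path_group T)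
       (lower_central (formal_closed_path_group T) n) g <->
     forall (k : nat) (mh : ncgroup R -> R[i]^o),
       (k <= n)%N -> is_formal_moment T k mh -> mh g = 0)) /\
  closure_in (closed_path_group T) (lower_central (closed_path_group T) n) =
  closure_in (formal_closed_path_group T)
    (lower_central (formal_closed_path_group T) n) `&` closed_path_group T.
Proof.
rewrite formal_closed_path_groupE.
have lcS : closure (lower_central (closed_path_group T) n) `<=`
    closure (lower_central (closure (closed_path_group T)) n).
  by apply: closureS; apply: lower_central_sub; exact: subset_closure.
split.
  move=> g Kg; split=> [[gn _] k mh kn /formal_moment_eq mhE|gmom].
    have Gg := closureS (@closed_path_group_sub R T) Kg.
    have [qs [q0 qk] ->] := mhE hT _ Gg.
    by apply: (closure_lower_central hT gn); rewrite q0 qk.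
  split=> //; apply: lcS; apply: moments_closure => // qs /andP[q0 qn].
  exact: gmom qn (mom_formal_moment hT q0).
apply/seteqP; split=> g.
  move=> [gn gK]; have gcK := subset_closure gK; split=> //; split=> //.
  exact: lcS.
(* Membership in the formal closure makes the moments vanish, and [moments_closure] then
   approximates by commutators of genuine closed paths. *)
move=> [[gn gcK] gK]; split=> //; apply: moments_closure => //.
exact: (closure_lower_central hT gn).
Qed.
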